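(* Let $P$ be a stable graph property, and let $g, f: \mathbb{R}_{\geq 0} \rightarrow \mathbb{R}_{\geq 0}$ be non-decreasing functions satisfying the following conditions. (1) If $G$ is a graph satisfying $P$ with no vertices of degree $>d$, then $\operatorname{reg}(I(G)) \leq g(d)$. (2) The function $f$ is concave-down and twice-differentiable, and $f(1) \geq 2$. (3) For all $x \in \mathbb{R}_{\geq 0}$, we have $f'(x)>0$, $1/f'(x)-1\ge 0$, and $g\left(1/f'(x) - 1\right) \leq f(x)$. Then for any graph $G$ on $n\ge 1$ vertices satisfying $P$, we have $\operatorname{reg}(I(G)) \leq f(n)$.
   Context: All graphs are finite and simple. For a vertex $x$ of $G$, the star of $x$ is $\operatorname{st} x=\{y\in V(G): (x,y)\text{ is an edge of }G\}\cup\{x\}$; $G-x$ and $G-\operatorname{st} x$ denote the induced subgraphs obtained by deleting $x$, respectively all vertices of $\operatorname{st} x$. A graph property $P$ is called stable if for any graph $G$ satisfying $P$ and any vertex $x$ of $G$ of maximal degree, both $G-\operatorname{st} x$ and $G-x$ satisfy $P$. Let $K$ be a fixed field and let $S$ be the polynomial ring over $K$ whose variables are the vertices of $G$ (standard graded). The edge ideal is $I(G) = (xy : (x,y) \text{ is an edge of } G)\subset S$. The Castelnuovo–Mumford regularity of a graded $S$-module $M$ is $\operatorname{reg}(M)=\max\{\,j-m : \operatorname{Tor}^S_m(M,K)_j\neq 0\,\}$; by convention $\operatorname{reg}(I(G))=2$ when $G$ has no edges. *)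

(* Defs.v *)
From HB Require Import structures.
From mathcomp Require Import all_boot all_order all_algebra.
From mathcomp Require Import mpoly.
From mathcomp Require Import boolp classical_sets reals ereal topology.
From mathcomp Require Import normedtype.

Set Implicit Arguments.
Unset Strict Implicit.
Unset Printing Implicit Defensive.
Import Order.TTheory GRing.Theory Num.Theory numFieldNormedType.Exports.

Local Open Scope ring_scope.

(* The graph without vertices is allowed: it occurs as G - st x. *)
Record sgraph := SGraph {
  svertex :> finType;
  sedge : rel svertex;
  sedge_sym : ssrbool.symmetric sedge;
  sedge_irr : irreflexive sedge
}.

Section Graphs.
Variable G : sgraph.

Definition degree (x : G) : nat := #|[set y | sedge x y]|.

Definition star (x : G) : {set G} := [set y | sedge x y] :|: [set x].

Section Delete.
Variable D : {set G}.

Definition delete_edge : rel {x : G | x \notin D} :=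
  fun u v => sedge (val u) (val v).

Fact delete_edge_sym : ssrbool.symmetric delete_edge.
Proof. by move=> u v; rewrite /delete_edge sedge_sym. Qed.

Fact delete_edge_irr : irreflexive delete_edge.
Proof. by move=> u; rewrite /delete_edge sedge_irr. Qed.

Definition delete : sgraph := SGraph delete_edge_sym delete_edge_irr.
End Delete.

Definition has_max_degree (x : G) : Prop :=
  forall y : G, (degree y <= degree x)%N.

Definition edgeless : Prop := forall x y : G, ~~ sedge x y.
End Graphs.

Definition stable (P : sgraph -> Prop) : Prop :=
  forall (G : sgraph) (x : G), P G -> has_max_degree x ->
    P (delete (star x)) /\ P (delete [set x]).

Section Tor.
Variables (K : fieldType) (n : nat).
Local Notation S := {mpoly K[n]}.

(* p, read as an element of the shifted module S(-a), is homogeneous of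
   degree b. *)
Definition shifted_homog (a b : nat) (p : S) : bool :=
  all (fun mm => a + mdeg mm == b)%N (msupp p).

(* A graded free resolution  ... -> F_1 -> F_0 -> K -> 0  of the residue field
   K = S / (all variables).  F_m is free on rk m generators, the i-th one in
   degree gdeg m i; its elements are row vectors, and the matrices act on the
   right.  The augmentation sends the i-th generator of F_0 to aug i; a
   polynomial acts on K through its constant coefficient. *)
Record resolution := Resolution {
  rk : nat -> nat;
  gdeg : forall m, 'I_(rk m) -> nat;
  bdry : forall m, 'M[S]_(rk m.+1, rk m);
  aug : 'I_(rk 0) -> K;
  augmentation := fun u : 'rV[S]_(rk 0) =>
    \sum_i (u ord0 i)@_0%MM * aug i;
  bdry_homog : forall m i k,
    shifted_homog (gdeg k) (gdeg i) (bdry m i k);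
  aug_homog : forall i, aug i != 0 -> gdeg i = 0%N;
  aug_surj : forall c : K, exists u, augmentation u = c;
  exact_aug : forall u : 'rV[S]_(rk 0),
    augmentation u = 0 <-> exists w, u = w *m bdry 0;
  exact_bdry : forall m (u : 'rV[S]_(rk m.+1)),
    u *m bdry m = 0 <-> exists w, u = w *m bdry m.+1
}.

Variable I : S -> Prop.

(* For an ideal I, the degree j part of I (x)_S F_m consists of the row
   vectors of F_m of degree j with all entries in I. *)
Definition tensor_chain (F : resolution) (m j : nat) (u : 'rV[S]_(rk F m)) :
    Prop :=
  forall i, I (u ord0 i) /\ shifted_homog (gdeg i) j (u ord0 i).

Definition tensor_cycle (F : resolution) (m : nat) :
    'rV[S]_(rk F m) -> Prop :=
  match m with
  | 0 => fun _ => True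
  | m'.+1 => fun u => u *m bdry F m' = 0
  end.

(* Tor^S_m(I, K)_j <> 0, where Tor^S(I, K) is the homology of I (x)_S F for a
   graded free resolution F of K.  Up to isomorphism this homology does not
   depend on F. *)
Definition Tor_neq0 (m j : nat) : Prop :=
  exists (F : resolution) (u : 'rV[S]_(rk F m)),
    [/\ tensor_chain j u, tensor_cycle u &
        ~ exists w : 'rV[S]_(rk F m.+1),
            tensor_chain j w /\ u = w *m bdry F m].

(* The maximum of j - m over the nonzero Tor^S_m(I, K)_j, taken as a supremum
   of extended reals so that the definition is total. *)
Definition reg (R : realType) : \bar R :=
  ereal_sup [set r | exists m j : nat,
    Tor_neq0 m j /\ r = (j%:R - m%:R)%:E]%classic.
End Tor.

Section EdgeIdeal.
Variables (K : fieldType) (G : sgraph).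
Local Notation S := {mpoly K[#|G|]}.

Definition var (x : G) : S := 'X_(enum_rank x).

Definition edge_ideal (p : S) : Prop :=
  exists c : G -> G -> S,
    p = \sum_(x : G) \sum_(y : G | sedge x y) c x y * (var x * var y).

Definition reg_edge_ideal (R : realType) : \bar R :=
  if `[< edgeless G >] then 2%:E else reg edge_ideal R.
End EdgeIdeal.

Section RealFunctions.
Variable R : realType.

Definition nonneg_valued (f : R -> R) : Prop := forall x, 0 <= x -> 0 <= f x.

Definition nondecreasing_nonneg (f : R -> R) : Prop :=
  forall x y, 0 <= x -> x <= y -> f x <= f y.

Definition concave_nonneg (f : R -> R) : Prop :=
  forall x y t, 0 <= x -> 0 <= y -> 0 <= t -> t <= 1 ->
    t * f x + (1 - t) * f y <= f (t * x + (1 - t) * y).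

(* f' is the derivative of f on [0, +oo[; at 0 it is the right derivative. *)
Definition derivative_nonneg (f f' : R -> R) : Prop :=
  forall x, 0 <= x ->
    ((fun y => (f y - f x) / (y - x)) @
       within [set y | 0 <= y]%classic (dnbhs x) --> f' x)%classic.
End RealFunctions.

(* Main.v *)
Require Import Defs.
From HB Require Import structures.
From mathcomp Require Import all_boot all_order all_algebra.
From mathcomp Require Import mpoly.
From mathcomp Require Import boolp classical_sets reals ereal topology normedtype.
From mathcomp Require Import finset.

(* Induction on the number of vertices.  If no degree exceeds 1/f'(n) - 1, the
   bound by g is enough.  Otherwise a vertex x of maximal degree D has
   (D + 1) f'(n) > 1, so f(n - D - 1) + 1 <= f(n) by concavity, and one uses
     reg I(G) <= max (reg I(G - x), reg I(G - st x) + 1).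
   That inequality is proved on Koszul homology of monomial ideals.  For a
   monomial ideal E and a variable x, a Koszul cycle u with entries in E becomes
   a boundary in the remaining variables once x is set to 0; subtracting a lift
   of that boundary leaves x * w with w a cycle in the colon ideal (E : x).  If
   (E : x) = E then x * w is a boundary, as x is null-homotopic on the Koszul
   complex.  For E = I(G) the colon ideal is I(G - st x) + (neighbours of x), and
   the neighbours are then removed one at a time, with colon ideal the whole
   ring.  Chain maps and homotopies between resolutions of the residue field
   carry the vanishing from the Koszul complex to every resolution. *)

Set Implicit Arguments.
Unset Strict Implicit.
Unset Printing Implicit Defensive.
Import Order.TTheory GRing.Theory Num.Theory numFieldNormedType.Exports.

Local Open Scope ring_scope.

(** * Supports of polynomials and monomial substitutions *)

Section Support.
Variables (K : fieldType) (n : nat).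
Implicit Types (p q : {mpoly K[n]}) (B C D : 'X_{1..n} -> Prop).

(** A monomial ideal is handled through the set B of its monomials. B is an arbitrary set of
    monomials, so it can also record a degree or the absence of a variable. *)
Definition supp B p : Prop := forall m, m \in msupp p -> B m.

Lemma suppW B C p : (forall m, B m -> C m) -> supp B p -> supp C p.
Proof. by move=> sBC sp m /sp /sBC. Qed.

Lemma supp0 B : supp B 0.
Proof. by move=> m; rewrite mcoeff_msupp mcoeff0 eqxx. Qed.

Lemma suppD B p q : supp B p -> supp B q -> supp B (p + q).
Proof.
by move=> sp sq m /msuppD_le; rewrite mem_cat => /orP[/sp|/sq].
Qed.

Lemma suppN B p : supp B p -> supp B (- p).
Proof. by move=> sp m; rewrite mcoeff_msupp mcoeffN oppr_eq0 -mcoeff_msupp => /sp. Qed.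

Lemma supp_sum B (I : Type) (r : seq I) (P : pred I) (F : I -> {mpoly K[n]}) :
  (forall i, P i -> supp B (F i)) -> supp B (\sum_(i <- r | P i) F i).
Proof.
move=> sF; elim/big_rec: _ => [|i p Pi sp]; first exact: supp0.
by apply: suppD => //; exact: sF.
Qed.

Lemma suppM B C D p q : (forall m m', B m -> C m' -> D (m + m')%MM) ->
  supp B p -> supp C q -> supp D (p * q).
Proof.
move=> BCD sp sq m /msuppM_le /allpairsP[[m1 m2] [/= /sp B1 /sq C2 ->]].
exact: BCD.
Qed.

Lemma suppX B m : supp B 'X_[m] <-> B m.
Proof.
split=> [sB|Bm m']; first by apply: sB; rewrite msuppX mem_head.
by rewrite msuppX inE => /eqP ->.
Qed.

Lemma suppZ B c p : supp B p -> supp B (c *: p).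
Proof. by move=> sp m /msuppZ_le /sp. Qed.

Lemma suppXM B i p : supp (fun m => B (m + U_(i))%MM) p -> supp B ('X_i * p).
Proof.
move=> sp; apply: (@suppM (eq U_(i)%MM) _ B 'X_i p _ _ sp); last exact/suppX.
by move=> m m' <-; rewrite addmC.
Qed.

Lemma supp_eq0 B p : (forall m, ~ B m) -> supp B p -> p = 0.
Proof.
move=> noB sp; apply/mpolyP => m; rewrite mcoeff0; apply/eqP/negPn.
by rewrite -mcoeff_msupp; apply/negP => /sp; exact: noB.
Qed.

Definition rsupp B r (u : 'rV[{mpoly K[n]}]_r) : Prop :=
  forall i, supp B (u ord0 i).

Lemma rsuppW B C r (u : 'rV_r) :
  (forall m, B m -> C m) -> rsupp B u -> rsupp C u.
Proof. by move=> sBC su i; apply: suppW (su i). Qed.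

Lemma rsupp0 B r : rsupp B (0 : 'rV_r).
Proof. by move=> i; rewrite mxE; exact: supp0. Qed.

Lemma rsuppD B r (u w : 'rV_r) : rsupp B u -> rsupp B w -> rsupp B (u + w).
Proof. by move=> su sw i; rewrite mxE; apply: suppD. Qed.

Lemma rsuppN B r (u : 'rV_r) : rsupp B u -> rsupp B (- u).
Proof. by move=> su i; rewrite mxE; apply: suppN. Qed.

Lemma rsupp_row_mx B r s (a : 'rV_r) (b : 'rV_s) :
  rsupp B (row_mx a b) <-> rsupp B a /\ rsupp B b.
Proof.
split=> [sab|[sa sb] i]; last by rewrite mxE; case: split.
by split=> i; [have := sab (lshift s i)|have := sab (rshift r i)];
  rewrite ?row_mxEl ?row_mxEr.
Qed.

Lemma rsuppXZ B r i (u : 'rV_r) :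
  rsupp (fun m => B (m + U_(i))%MM) u -> rsupp B ('X_i *: u).
Proof. by move=> su j; rewrite mxE; apply: suppXM. Qed.

Lemma rsupp_eq0 B r (u : 'rV_r) : (forall m, ~ B m) -> rsupp B u -> u = 0.
Proof.
by move=> noB su; apply/rowP => i; rewrite mxE; apply: supp_eq0 (su i).
Qed.
End Support.

Section VarSubst.
Variables (K : fieldType) (n n' : nat) (h : 'I_n -> option 'I_n').

(** [None] sends a variable to 0. Setting a variable to 0 and moving between rings with different
    variables are thus both instances of [var_subst]. *)
Definition subst_var (i : 'I_n) : {mpoly K[n']} :=
  if h i is Some j then 'X_j else 0.

Definition var_subst : {mpoly K[n]} -> {mpoly K[n']} :=
  mmap (@mpolyC n' K) subst_var.

HB.instance Definition _ := GRing.RMorphism.on var_subst.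

(* The exponent of the image of 'X^m, when no variable of 'X^m is sent to 0. *)
Definition push_monomial (m : 'X_{1..n}) : 'X_{1..n'} :=
  [multinom (\sum_(i | h i == Some j) m i)%N | j < n'].

Lemma var_substE p : var_subst p = \sum_(m <- msupp p) p@_m *: var_subst 'X_[m].
Proof.
rewrite {1}[p]mpolyE raddf_sum; apply: eq_bigr => m _.
by rewrite /= /var_subst mmapZ mul_mpolyC.
Qed.

Lemma var_substX m : var_subst 'X_[m] =
  if [forall i, (m i != 0%N) ==> (h i != None)] then 'X_[push_monomial m] else 0.
Proof.
rewrite /var_subst mmapX /mmap1; case: ifPn => [/forallP hm|]; last first.
  rewrite negb_forall => /existsP[i]; rewrite negb_imply negbK => /andP[mi /eqP hi].
  by rewrite (bigD1 i) //= /subst_var hi expr0n (negbTE mi) mul0r.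
rewrite [RHS]mpolyXE_id.
have -> : \prod_(i < n) subst_var i ^+ m i =
          \prod_(i < n | h i != None) subst_var i ^+ m i.
  rewrite [RHS]big_mkcond /=; apply: eq_bigr => i _; case: ifP => // hi.
  by have := hm i; rewrite hi implybF negbK => /eqP ->; rewrite expr0.
rewrite (eq_bigr (fun i => \prod_(j < n' | h i == Some j) 'X_j ^+ m i)); last first.
  move=> i; rewrite /subst_var; case: (h i) => // j _.
  by rewrite (big_pred1 j) // => j'; rewrite [RHS]eq_sym.
rewrite (exchange_big_dep predT) //=; apply: eq_bigr => j _.
rewrite mnmE -prodrXr; apply: eq_bigl => i.
by case: (h i).
Qed.

Lemma var_subst_supp (B : 'X_{1..n} -> Prop) (C : 'X_{1..n'} -> Prop) p :
  (forall m, B m -> (forall i, m i != 0%N -> h i) -> C (push_monomial m)) ->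
  supp B p -> supp C (var_subst p).
Proof.
move=> BC sp; rewrite var_substE big_seq; apply: supp_sum => m /sp Bm.
apply: suppZ; rewrite var_substX; case: ifP => [/forallP hm|_]; last exact: supp0.
apply/suppX/BC => // i mi; have /implyP/(_ mi) := hm i.
by case: (h i).
Qed.

Lemma var_substU i : var_subst 'X_i = subst_var i.
Proof. by rewrite /var_subst mmapX mmap1U. Qed.
End VarSubst.

Lemma eq_mpoly_rmorph (K : fieldType) n n'
    (f g : {rmorphism {mpoly K[n]} -> {mpoly K[n']}}) p :
  (forall c, f c%:MP = g c%:MP) ->
  (forall m, m \in msupp p -> f 'X_[m] = g 'X_[m]) -> f p = g p.
Proof.
move=> fgC fgX; rewrite [p]mpolyE !raddf_sum /= big_seq [RHS]big_seq.
by apply: eq_bigr => m mp; rewrite -mul_mpolyC !rmorphM /= fgC fgX.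
Qed.

Lemma var_substC (K : fieldType) n n' (h : 'I_n -> option 'I_n') c :
  var_subst h c%:MP = c%:MP :> {mpoly K[n']}.
Proof. by rewrite /var_subst mmapC. Qed.

Lemma var_subst_comp_id (K : fieldType) n n' (h : 'I_n -> option 'I_n')
    (h' : 'I_n' -> option 'I_n) (p : {mpoly K[n]}) :
  supp (fun m => forall i, m i != 0%N -> exists2 j, h i = Some j & h' j = Some i) p ->
  var_subst h' (var_subst h p) = p.
Proof.
move=> sp; rewrite -[RHS]/(idfun p).
apply: (@eq_mpoly_rmorph _ _ _ (var_subst h' \o var_subst h) idfun) => [c|m /sp hm] /=.
  by rewrite !var_substC.
rewrite mpolyXE_id !rmorph_prod /=; apply: eq_bigr => i _.
have [->|/hm[j hi hj]] := eqVneq (m i) 0%N; first by rewrite expr0 !rmorph1.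
by rewrite !rmorphXn /= var_substU /subst_var hi var_substU /subst_var hj.
Qed.

(** * Setting one variable to zero and dividing by it *)

Section KillVariable.
Variables (K : fieldType) (n : nat) (x : 'I_n).
Local Notation S := {mpoly K[n]}.

Definition avoid_hom (i : 'I_n) : option 'I_n := if i == x then None else Some i.

Definition kill : S -> S := var_subst avoid_hom.

HB.instance Definition _ := GRing.RMorphism.on kill.

(** The quotient in the division of p by x, [kill p] being the remainder. Both act monomial by
    monomial, so they respect monomial supports. *)
Definition divX (p : S) : S :=
  \sum_(m <- msupp p | m x != 0%N) p@_m *: 'X_[m - U_(x)].

Lemma push_monomial_avoid (m : 'X_{1..n}) : m x = 0%N -> push_monomial avoid_hom m = m.
Proof.
move=> mx; apply/mnmP => j; rewrite mnmE.
have [->|jx] := eqVneq j x.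
  rewrite mx big1 // => i; rewrite /avoid_hom; case: ifP => // ix /eqP[ixE].
  by rewrite ixE mx.
rewrite (big_pred1 j) // => i; rewrite /= /avoid_hom; case: ifP => [/eqP ->|_].
  by rewrite [RHS]eq_sym (negbTE jx).
by [].
Qed.

Lemma killX m : kill 'X_[m] = if m x == 0%N then 'X_[m] else 0.
Proof.
rewrite /kill var_substX; case: (eqVneq (m x) 0%N) => [mx|mx].
  rewrite push_monomial_avoid // ifT //; apply/forallP => i; apply/implyP.
  by rewrite /avoid_hom; case: (eqVneq i x) => [->|//]; rewrite mx.
rewrite ifF //; apply/negbTE/forallPn; exists x.
by rewrite negb_imply mx /avoid_hom eqxx.
Qed.

Lemma kill_divX p : p = kill p + 'X_x * divX p.
Proof.
rewrite /kill var_substE -/kill mulr_sumr {1}[p]mpolyE.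
rewrite [X in _ + X]big_mkcond -big_split /=; apply: eq_bigr => m _.
rewrite killX.
case: eqVneq => mx /=; first by rewrite addr0.
by rewrite scaler0 add0r -scalerAr -mpolyXD addmC submK // lep1mP.
Qed.

Lemma kill_supp (B : 'X_{1..n} -> Prop) p :
  supp B p -> supp (fun m => B m /\ m x = 0%N) (kill p).
Proof.
apply: var_subst_supp => m Bm hm.
have mx : m x = 0%N by apply/eqP/negPn/negP => /hm; rewrite /avoid_hom eqxx.
by rewrite push_monomial_avoid.
Qed.

Lemma divX_supp (B : 'X_{1..n} -> Prop) p :
  supp B p -> supp (fun m => B (m + U_(x))%MM) (divX p).
Proof.
move=> sp; rewrite /divX big_seq_cond; apply: supp_sum => m /andP[/sp Bm mx].
by apply: suppZ; apply: (proj2 (suppX K _ _)); rewrite submK // lep1mP.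
Qed.

Lemma killXx : kill 'X_x = 0.
Proof. by rewrite killX mnm1E eqxx. Qed.

Lemma killXi i : i != x -> kill 'X_i = 'X_i.
Proof. by move=> ix; rewrite killX mnm1E (negbTE ix). Qed.

Lemma kill_divX_row r (u : 'rV_r) :
  u = map_mx kill u + 'X_x *: map_mx divX u.
Proof. by apply/rowP => i; rewrite !mxE -kill_divX. Qed.

Lemma kill_rsupp (B : 'X_{1..n} -> Prop) r (u : 'rV_r) :
  rsupp B u -> rsupp (fun m => B m /\ m x = 0%N) (map_mx kill u).
Proof. by move=> su i; rewrite mxE; apply: kill_supp. Qed.

Lemma divX_rsupp (B : 'X_{1..n} -> Prop) r (u : 'rV_r) :
  rsupp B u -> rsupp (fun m => B (m + U_(x))%MM) (map_mx divX u).
Proof. by move=> su i; rewrite mxE; apply: divX_supp. Qed.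

Lemma scaleX_inj r s (A : 'M[S]_(r, s)) : 'X_x *: A = 0 -> A = 0.
Proof.
move=> XA; apply/matrixP => i j; have /matrixP/(_ i j) := XA.
rewrite !mxE => /eqP; rewrite mulf_eq0 => /orP[|/eqP //].
by rewrite -msupp_eq0 msuppX.
Qed.
End KillVariable.

(** * Koszul complexes *)

(* The Koszul complex on v 0, ..., v k as the mapping cone of multiplication by
   v k on the complex on v 0, ..., v (k-1).  The rank [krk k m] is 'C(k, m);
   [krk_pred], [mx_pred] and [kdiff] extend by 0 to degree -1, so that degree 0
   needs no separate treatment. *)
Fixpoint krk (k m : nat) : nat :=
  if k is k'.+1 then (krk k' m + (if m is m'.+1 then krk k' m' else 0))%N
  else if m is 0 then 1%N else 0%N.

Definition krk_pred (k m : nat) : nat := if m is m'.+1 then krk k m' else 0%N.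

Definition mx_pred (A : pzRingType) k (D : forall m, 'M[A]_(krk k m.+1, krk k m)) m :
    'M[A]_(krk k m, krk_pred k m) :=
  match m with 0 => 0 | m'.+1 => D m' end.

Fixpoint koszul (A : pzRingType) (v : nat -> A) k m : 'M[A]_(krk k m.+1, krk k m) :=
  match k with
  | 0 => 0
  | k'.+1 => block_mx (koszul v k' m) 0 (v k')%:M (- mx_pred (koszul v k') m)
  end.

Definition kdiff (A : pzRingType) (v : nat -> A) k m : 'M[A]_(krk k m, krk_pred k m) :=
  mx_pred (koszul v k) m.

Section KoszulRing.
Variables (A : comNzRingType) (v : nat -> A).

Lemma map_koszul (A' : pzRingType) (f : {rmorphism A -> A'}) (v' : nat -> A') k m :
  (forall i, (i < k)%N -> f (v i) = v' i) ->
  map_mx f (koszul v k m) = koszul v' k m.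
Proof.
elim: k m => [|k IH] m fv /=; first by rewrite map_mx0.
have {}IH m' : map_mx f (koszul v k m') = koszul v' k m'.
  by apply: IH => i ik; apply/fv/ltnW.
rewrite (@map_block_mx _ _ f) IH map_mx0 map_scalar_mx fv // map_mxN; congr block_mx.
by case: m => [|m] /=; rewrite ?map_mx0 ?IH.
Qed.

Lemma map_kdiff (A' : pzRingType) (f : {rmorphism A -> A'}) (v' : nat -> A') k m :
  (forall i, (i < k)%N -> f (v i) = v' i) ->
  map_mx f (kdiff v k m) = kdiff v' k m.
Proof. by case: m => [|m] fv; [exact: map_mx0 | exact: map_koszul]. Qed.

(** The cross terms in the square of the cone differential are [v k] times the smaller differential
    and its negative; the sign in the last block makes them cancel. *)
Lemma koszulK k m : koszul v k m *m kdiff v k m = 0.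
Proof.
elim: k m => [|k IH] [|m]; rewrite ?mulmx0 ?mul0mx //=.
rewrite (mulmx_block (koszul v k m.+1)) !mulmx0 !mul0mx (IH m.+1) addr0 add0r.
rewrite !mulNmx mulmxN mul_scalar_mx mul_mx_scalar subrr IH !oppr0.
by rewrite add0r block_mx0.
Qed.

Lemma row_koszul k m (a : 'rV_(krk k m.+1)) (b : 'rV_(krk k m)) :
  row_mx a b *m koszul v k.+1 m =
  row_mx (a *m koszul v k m + v k *: b) (- (b *m kdiff v k m)).
Proof.
rewrite (mul_row_block a b (koszul v k m)) mulmx0 add0r mulmxN.
by rewrite mul_mx_scalar.
Qed.

Lemma kdiff_row k m (a : 'rV_(krk k m)) (b : 'rV_(krk_pred k m)) :
  row_mx a b *m kdiff v k.+1 m = 0 -> a *m kdiff v k m + v k *: b = 0.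
Proof.
case: m a b => [|m] a b; first by move=> _; apply/rowP; case.
rewrite [kdiff _ _ _]/(koszul v k.+1 m) row_koszul => /eqP.
by rewrite row_mx_eq0 => /andP[/eqP].
Qed.

Lemma kdiff_row_pred k m (a : 'rV_(krk k m.+1)) (b : 'rV_(krk k m)) :
  row_mx a b *m kdiff v k.+1 m.+1 = 0 -> b *m kdiff v k m = 0.
Proof.
rewrite [kdiff _ _ _]/(koszul v k.+1 m) row_koszul => /eqP.
by rewrite row_mx_eq0 => /andP[_]; rewrite oppr_eq0 => /eqP.
Qed.
End KoszulRing.

Definition kvar (K : fieldType) n (v : nat -> 'I_n) i : {mpoly K[n]} := 'X_(v i).

(** * Vanishing of Koszul homology, one variable at a time *)

Section Vanishing.
Variables (K : fieldType) (n : nat) (v : nat -> 'I_n).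
Local Notation S := {mpoly K[n]}.
Local Notation X := (kvar K v).

(** The differential raises the degree of entries by one, hence two supports: with B the degree t +
    1 part of a monomial ideal and C its degree t part, this is the vanishing of a graded piece of
    Koszul homology. *)
Definition koszul_vanish k (B C : 'X_{1..n} -> Prop) : Prop :=
  forall m (u : 'rV[S]_(krk k m)), rsupp B u -> u *m kdiff X k m = 0 ->
  exists2 w, rsupp C w & u = w *m koszul X k m.

(** Once x is set to 0, the cone on x splits into two copies of the complex on the first k
    variables, so [vanish_kill] bounds the two components of a cycle separately. What remains is x
    times a cycle with entries in the colon ideal. *)
Lemma koszul_vanish_step k (B C : 'X_{1..n} -> Prop) (x := v k) :
  (forall i, (i < k)%N -> v i != x) ->
  (forall m, C m -> m x = 0%N -> B (m + U_(x))%MM) ->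
  koszul_vanish k (fun m => B m /\ m x = 0%N) (fun m => C m /\ m x = 0%N) ->
  koszul_vanish k.+1 (fun m => B (m + U_(x))%MM) (fun m => C (m + U_(x))%MM) \/
    (forall m, B (m + U_(x))%MM -> C m) ->
  koszul_vanish k.+1 B C.
Proof.
move=> vx CB vanish_kill vanish_colon m u.
rewrite -[u](@hsubmxK _ _ (krk k m) (krk_pred k m)).
move: (lsubmx _) (rsubmx _) => a b {u} /rsupp_row_mx[sa sb] cyc.
have kX i : (i < k)%N -> kill x (X i) = X i by move=> ik; rewrite /kvar killXi // vx.
have killD w : map_mx (kill x) (w *m kdiff X k m) =
    map_mx (kill x) w *m kdiff X k m :> 'rV__.
  by rewrite map_mxM (map_kdiff _ kX).
have cyc1 := kdiff_row cyc.
have [e [se eE]] : exists e : 'rV_(krk k m.+1), rsupp (fun m => C m /\ m x = 0%N) e /\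
    map_mx (kill x) a = e *m koszul X k m.
  have [||e se eE] := vanish_kill m (map_mx (kill x) a); first exact: kill_rsupp.
    rewrite -killD; have := congr1 (map_mx (kill x)) cyc1.
    by rewrite map_mxD map_mxZ map_mx0 [_ (X k)]killXx scale0r addr0.
  by exists e.
have [c [sc cE]] : exists c : 'rV_(krk k m), rsupp (fun m => C m /\ m x = 0%N) c /\
    map_mx (kill x) b = c *m kdiff X k m.
  (* In homological degree 0 the second component is an empty row. *)
  clear e se eE killD cyc1; case: m a b sa sb cyc => [|m] a b sa sb cyc.
    by exists 0; split; [exact: rsupp0 | apply/rowP; case].
  have cyc2 := kdiff_row_pred cyc.
  have [||c sc cE] := vanish_kill m (map_mx (kill x) b); first exact: kill_rsupp.
    by have := congr1 (map_mx (kill x)) cyc2; rewrite map_mxM (map_kdiff _ kX) map_mx0.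
  by exists c.
(* The boundary of (e, -c) is (e d - x c, c d); the summand [c] of [v1] compensates the term - x
   c. *)
pose v1 := map_mx (divX x) a + c; pose v2 := map_mx (divX x) b.
have sv1 : rsupp (fun m => B (m + U_(x))%MM) v1.
  apply: rsuppD; first exact: divX_rsupp.
  by apply: rsuppW sc => m' [Cm mx]; exact: CB.
have sv2 : rsupp (fun m => B (m + U_(x))%MM) v2 by exact: divX_rsupp.
have uE : row_mx a b = row_mx e (- c) *m koszul X k.+1 m + 'X_x *: row_mx v1 v2.
  rewrite row_koszul (@scale_row_mx _ _ (krk k m) (krk_pred k m)).
  rewrite (@add_row_mx _ _ (krk k m) (krk_pred k m)); congr row_mx.
    rewrite /v1 -[X k]/('X_x) scalerDr scalerN -eE addrACA addNr addr0.
    exact: kill_divX_row.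
  by rewrite mulNmx opprK -cE -kill_divX_row.
have cycv : row_mx v1 v2 *m kdiff X k.+1 m = 0.
  apply: (@scaleX_inj _ _ x); move: cyc.
  rewrite uE mulmxDl -mulmxA (koszulK X k.+1 m) mulmx0 add0r.
  by rewrite -scalemxAl.
have sec : rsupp C (row_mx e (- c)).
  apply/rsupp_row_mx; split; first by apply: rsuppW se => ? [].
  by apply: rsuppN; apply: rsuppW sc => ? [].
have [w sw wE] : exists2 w, rsupp C w & 'X_x *: row_mx v1 v2 = w *m koszul X k.+1 m.
  case: vanish_colon => [vanish|BC].
    have [|w sw wE] := vanish m (row_mx v1 v2) _ cycv; first exact/rsupp_row_mx.
    by exists ('X_x *: w); [exact: rsuppXZ | rewrite wE -scalemxAl].
  (* The null-homotopy of x sends (v1, v2) to (0, v1), whose boundary is (x v1, - v1 d); the cycle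
     condition gives - v1 d = x v2. *)
  exists (row_mx (0 : 'rV_(krk k m.+1)) v1).
    by apply/rsupp_row_mx; split; [exact: rsupp0 | apply: rsuppW sv1].
  rewrite row_koszul mul0mx add0r (@scale_row_mx _ _ (krk k m) (krk_pred k m)).
  congr row_mx; apply/eqP; rewrite -addr_eq0 addrC; apply/eqP.
  by have := kdiff_row cycv.
exists (row_mx e (- c) + w); first exact: rsuppD.
by rewrite mulmxDl -wE -uE.
Qed.

End Vanishing.

(** * The Koszul complex as a resolution of the residue field *)

Section KoszulResolution.
Variables (K : fieldType) (n : nat) (v : nat -> 'I_n).
Local Notation S := {mpoly K[n]}.
Local Notation X := (kvar K v).

Fixpoint kill_first k : {rmorphism S -> S} :=
  if k is k'.+1 then (kill_first k' \o kill (v k') : S -> S) else idfun.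

Lemma kill_first0 k p : (kill_first k p)@_0%MM = p@_0%MM.
Proof.
elim: k p => [//|k IH] p /=; rewrite IH [in RHS](kill_divX (v k) p).
by rewrite mcoeffD rmorphM /= mcoeffX mnm1_eq0 mul0r addr0.
Qed.

Lemma kill_first_supp k (B : 'X_{1..n} -> Prop) p : supp B p ->
  supp (fun m => B m /\ forall i, (i < k)%N -> m (v i) = 0%N) (kill_first k p).
Proof.
elim: k B p => [|k IH] B p sp; first by apply: suppW sp => m Bm; split.
have := IH _ _ (kill_supp (x := v k) sp); apply: suppW => m [[Bm mk] mi]; split=> // i.
by rewrite ltnS leq_eqVlt => /orP[/eqP ->|/mi].
Qed.

Lemma kill_firstX k i : (i < k)%N -> kill_first k (X i) = 0.
Proof.
elim: k => // k IH; rewrite ltnS leq_eqVlt /= => /orP[/eqP ->|ik].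
  by rewrite [kill _ _]killXx rmorph0.
rewrite /kvar killX; case: ifP => _; last by rewrite rmorph0.
exact: IH.
Qed.

Lemma kill_first_id k i : (forall j, (j < k)%N -> v j != v i) -> kill_first k (X i) = X i.
Proof.
elim: k => //= k IH vi; rewrite /kvar killXi; last by rewrite eq_sym vi.
by apply: IH => j jk; apply/vi/ltnW.
Qed.

Lemma koszul_const0 (A : comNzRingType) k m : koszul (fun _ => 0 : A) k m = 0.
Proof.
elim: k m => //= k IH m; rewrite IH raddf0.
have -> : mx_pred (koszul (fun=> 0) k) m = 0 :> 'M[A]__ by case: m => //= m; exact: IH.
by rewrite oppr0 block_mx0.
Qed.

Lemma kill_first_koszul k m r (u : 'M_(r, _)) :
  map_mx (kill_first k) (u *m koszul X k m) = 0.
Proof.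
rewrite map_mxM (map_koszul (v' := fun _ => 0)) ?koszul_const0 ?mulmx0 //.
exact: kill_firstX.
Qed.

(** Induction along the mapping cone, as for any regular sequence. The degree 0 homology is S modulo
    the first k variables; its zero elements are described as the kernel of [kill_first k], and
    [v k] acts injectively on it. *)
Lemma koszul_exact k : (forall i j, (i < j < k)%N -> v i != v j) ->
  (forall m (u : 'rV_(krk k m.+1)), u *m koszul X k m = 0 ->
     exists w, u = w *m koszul X k m.+1) /\
  (forall u : 'rV_(krk k 0), map_mx (kill_first k) u = 0 ->
     exists w, u = w *m koszul X k 0).
Proof.
elim: k => [|k IH] vP.
  split=> [m u _|u u0]; exists 0; rewrite mul0mx; first by apply/rowP; case.
  by rewrite -u0; apply/rowP => i; rewrite mxE.
have [|exS ex0] := IH; first by move=> i j /andP[ij jk]; rewrite vP // ij ltnW.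
have vk j : (j < k)%N -> v j != v k by move=> jk; rewrite vP // jk ltnSn.
split=> [m u|u].
  rewrite -[u](@hsubmxK _ _ (krk k m.+1) (krk k m)).
  move: (lsubmx _) (rsubmx _) => a b {u} cyc.
  have cyc1 : a *m koszul X k m + X k *: b = 0 by exact: (@kdiff_row _ X k m.+1 a b cyc).
  have cyc2 := @kdiff_row_pred _ X k m a b cyc.
  have [c bE] : exists c : 'rV_(krk k m.+1), b = c *m koszul X k m.
    case: m a b {cyc} cyc1 cyc2 => [|m] a b cyc1 cyc2; last exact: exS.
    (* In degree 0 the cycle condition makes [v k] times b a boundary; applying [kill_first k],
       which fixes [v k], and cancelling [v k] puts b in the kernel. *)
    apply: ex0; apply: (@scaleX_inj _ _ (v k)).
    have := congr1 (map_mx (kill_first k)) cyc1.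
    rewrite map_mxD map_mxZ map_mx0 kill_first_koszul add0r.
    by rewrite (kill_first_id vk).
  have [|e eE] := exS m (a + X k *: c); first by rewrite mulmxDl -scalemxAl -bE.
  exists (row_mx e (- c)); rewrite row_koszul; congr row_mx.
    by rewrite -eE scalerN addrK.
  by rewrite mulNmx opprK.
rewrite -[u](@hsubmxK _ _ (krk k 0) 0).
move: (lsubmx _) (rsubmx _) => a b {u} u0.
have [|e eE] := ex0 (a - X k *: map_mx (divX (v k)) a).
  have a0 : map_mx (kill_first k) (map_mx (kill (v k)) a) = 0.
    apply/rowP => i; have /rowP/(_ (lshift 0 i)) := u0.
    by rewrite !mxE (unsplitK (inl i)).
  rewrite -[RHS]a0; congr map_mx; apply/eqP; rewrite subr_eq; apply/eqP.
  exact: kill_divX_row.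
exists (row_mx e (map_mx (divX (v k)) a)); rewrite row_koszul; congr row_mx.
  by rewrite -eE addrNK.
by apply/rowP; case.
Qed.

Lemma koszul_entry k m i j : supp (fun mm => mdeg mm = 1%N) (koszul X k m i j).
Proof.
elim: k m i j => [|k IH] m i j /=; first by rewrite mxE; exact: supp0.
rewrite mxE; case: (split i) => {}i; rewrite mxE; case: (split j) => {}j.
- exact: IH.
- by rewrite mxE; exact: supp0.
- rewrite mxE; case: eqP => _; last exact: supp0.
  by rewrite mulr1n; apply/suppX/mdeg1.
- rewrite mxE; apply: suppN; case: m i j => [|m] i j; first by case: j.
  exact: IH.
Qed.

Hypothesis v_inj : forall i j, (i < j < n)%N -> v i != v j.
Hypothesis v_surj : forall y, exists2 i, (i < n)%N & v i = y.

Lemma krk0 k : krk k 0 = 1%N.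
Proof. by elim: k => //= k ->. Qed.

Lemma shifted_homogP a b (p : S) :
  shifted_homog a b p <-> supp (fun m => (a + mdeg m)%N = b) p.
Proof.
split=> [/allP sp m /sp /eqP //|sp]; apply/allP => m /sp /eqP //.
Qed.

Lemma kill_all p : kill_first n p = (p@_0%MM)%:MP.
Proof.
apply/mpolyP => m; rewrite mcoeffC; have [->|m0] := eqVneq m 0%MM.
  by rewrite mulr1 kill_first0.
rewrite mulr0; apply/eqP; rewrite mcoeff_eq0; apply/negP => mp.
have [//|_ mv] := @kill_first_supp n (fun _ => True) p _ m mp.
case/eqP: m0; apply/mnmP => y; rewrite mnm0E.
by have [i /mv + <-] := v_surj y.
Qed.

Program Definition koszul_resolution : resolution K n :=
  @Resolution K n (krk n) (fun m _ => m) (koszul X n) (fun _ => 1) _ _ _ _ _.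
Next Obligation.
move=> m i k /=.
apply/shifted_homogP; apply: (suppW _ (@koszul_entry _ _ _ _)) => mm ->.
exact: addn1.
Qed.
Next Obligation.
by [].
Qed.
Next Obligation.
move=> c; exists (const_mx c%:MP); rewrite (eq_bigr (fun=> c)) => [|i _]; last first.
  by rewrite mxE mulr1 mpolyCK.
by rewrite sumr_const card_ord krk0.
Qed.
Next Obligation.
move=> u; have aug0 : (\sum_i (u ord0 i)@_0%MM * 1 == 0) =
    (map_mx (kill_first n) u == 0).
  (* [krk n 0] equals 1 without reducing to it, so the unique index is named. *)
  have [i0 i0P] : exists i0 : 'I_(krk n 0), forall i, i = i0.
    move: u; rewrite krk0 => _; exists ord0 => i; exact: ord1.
  rewrite (big_pred1 i0) => [|i]; last by rewrite (i0P i) /= eqxx.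
  rewrite mulr1; apply/eqP/eqP => [u0|/rowP/(_ i0)].
    by apply/rowP => i; rewrite (i0P i) !mxE kill_all u0 mpolyC0.
  by rewrite !mxE kill_all => /(congr1 (mcoeff 0%MM)); rewrite mpolyCK mcoeff0.
split=> [/eqP|[w uE]].
  by rewrite aug0 => /eqP; exact: (proj2 (koszul_exact v_inj)).
by apply/eqP; rewrite aug0 uE kill_first_koszul eqxx.
Qed.
Next Obligation.
move=> m u; split=> [|[w ->]]; first exact: (proj1 (koszul_exact v_inj)).
by rewrite -mulmxA (koszulK X n m.+1) mulmx0.
Qed.

End KoszulResolution.

Arguments shifted_homogP {K n a b p}.

(** * Independence of the resolution *)

(** Dependent choice with a type varying with the index: chain maps and homotopies are sequences of
    matrices of varying size, each built from the previous one. *)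
Lemma dep_nat_choice (T : nat -> Type) (P : forall m, T m -> Prop)
    (R : forall m, T m -> T m.+1 -> Prop) (Q : T 0%N -> Prop) :
  (exists2 x, P 0%N x & Q x) ->
  (forall m x, P m x -> exists2 y, P m.+1 y & R m x y) ->
  exists f : forall m, T m,
    [/\ Q (f 0%N), forall m, P m (f m) & forall m, R m (f m) (f m.+1)].
Proof.
move=> /cid2[x0 Px0 Qx0] PR.
have next m (x : {x : T m | P m x}) :
    {y : {y : T m.+1 | P m.+1 y} | R m (sval x) (sval y)}.
  by have [y Py Rxy] := cid2 (PR _ _ (svalP x)); exists (exist _ y Py).
pose f := fix f m : {x : T m | P m x} :=
  if m is m'.+1 then sval (next m' (f m')) else exist _ x0 Px0.
exists (fun m => sval (f m)); split=> [//|m|m]; first exact: svalP.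
exact: svalP (next m (f m)).
Qed.

(** * Homogeneous matrices and homogeneous components *)

Section Homogeneous.
Variables (K : fieldType) (n : nat).
Local Notation S := {mpoly K[n]}.

Definition hom_mx r s (e : 'I_r -> nat) (g : 'I_s -> nat) (A : 'M[S]_(r, s)) : Prop :=
  forall i k, shifted_homog (g k) (e i) (A i k).

Lemma hom_mx1 r (e : 'I_r -> nat) : hom_mx e e 1%:M.
Proof.
move=> i k; rewrite mxE; apply/shifted_homogP.
have [->|_] := eqVneq i k; last exact: supp0.
by rewrite -mpolyX0; apply/suppX; rewrite mdeg0 addn0.
Qed.

Lemma hom_mxB r s (e : 'I_r -> nat) (g : 'I_s -> nat) A B :
  hom_mx e g A -> hom_mx e g B -> hom_mx e g (A - B).
Proof.
move=> hA hB i k; rewrite !mxE; apply/shifted_homogP.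
by apply: suppD; [|apply: suppN]; apply/shifted_homogP.
Qed.

Lemma shifted_homogM a b c (p q : S) :
  shifted_homog b c p -> shifted_homog a b q -> shifted_homog a c (p * q).
Proof.
move=> /shifted_homogP hp /shifted_homogP hq; apply/shifted_homogP.
apply: suppM hp hq => m m' <- <-; rewrite mdegD [(mdeg m + _)%N]addnC; exact: addnA.
Qed.

Lemma shifted_homog_sum a b (I : Type) (r : seq I) (F : I -> S) :
  (forall i, shifted_homog a b (F i)) -> shifted_homog a b (\sum_(i <- r) F i).
Proof.
by move=> hF; apply/shifted_homogP; apply: supp_sum => i _; apply/shifted_homogP.
Qed.

Lemma hom_mxM r s t (e : 'I_r -> nat) (g : 'I_s -> nat) (h : 'I_t -> nat) A B :
  hom_mx e g A -> hom_mx g h B -> hom_mx e h (A *m B).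
Proof.
move=> hA hB i k; rewrite mxE; apply: shifted_homog_sum => j.
exact: shifted_homogM (hA i j) (hB j k).
Qed.

Definition hom_part a b (p : S) : S :=
  \sum_(m <- msupp p | (a + mdeg m)%N == b) p@_m *: 'X_[m].

Lemma hom_partP a b p : shifted_homog a b (hom_part a b p).
Proof.
apply/shifted_homogP; apply: supp_sum => m /eqP abm.
by apply: suppZ; apply: (proj2 (suppX _ _ _)).
Qed.

Lemma hom_part_rest a b p : supp (fun m => (a + mdeg m)%N <> b) (p - hom_part a b p).
Proof.
rewrite {1}[p]mpolyE (bigID (fun m => (a + mdeg m)%N == b)) /= addrAC subrr add0r.
by apply: supp_sum => m /eqP abm; apply: suppZ; apply: (proj2 (suppX _ _ _)).
Qed.

(** Each entry of [w] is replaced by its component of the right degree. The homogeneous matrix [B]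
    sends the remainder to entries with no part of degree e; their image is also homogeneous of
    degree e, hence 0. *)
Lemma hom_part_solution r s (e : nat) (g : 'I_r -> nat) (h : 'I_s -> nat)
    (B : 'M_(r, s)) (w : 'rV_r) :
  hom_mx g h B -> (forall k, shifted_homog (h k) e ((w *m B) ord0 k)) ->
  exists2 w' : 'rV_r, forall i, shifted_homog (g i) e (w' ord0 i) & w *m B = w' *m B.
Proof.
move=> hB hwB; exists (\row_i hom_part (g i) e (w ord0 i)) => [i|].
  by rewrite mxE; exact: hom_partP.
apply/eqP; rewrite -subr_eq0 -mulmxBl; apply/eqP/rowP => k; rewrite [RHS]mxE.
have /shifted_homogP sE : shifted_homog (h k) e
    (((w - \row_i hom_part (g i) e (w ord0 i)) *m B) ord0 k).
  rewrite mulmxBl mxE; apply/shifted_homogP; apply: suppD; first exact/shifted_homogP.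
  rewrite mxE; apply: suppN; apply/shifted_homogP; rewrite mxE; apply: shifted_homog_sum => i.
  by apply: shifted_homogM (hB i k); rewrite mxE; exact: hom_partP.
move: sE; rewrite [_ ord0 k]mxE => sE.
apply/eqP; rewrite -msupp_eq0; case ms: (msupp _) => [//|m t].
have := sE m; rewrite ms mem_head => /(_ isT) mE.
suff /(_ m) : supp (fun m => (h k + mdeg m)%N <> e)
    (\sum_j (w - \row_i hom_part (g i) e (w ord0 i)) ord0 j * B j k).
  by rewrite ms mem_head => /(_ isT).
apply: supp_sum => i _; rewrite !mxE.
have /shifted_homogP sB := hB i k.
apply: suppM (@hom_part_rest (g i) e (w ord0 i)) sB => m1 m2 m1E m2E m12E; apply: m1E.
by rewrite -m12E -m2E mdegD addnAC -addnA.
Qed.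
End Homogeneous.

(** * Chain maps and homotopies between resolutions *)

Section Comparison.
Variables (K : fieldType) (n : nat).
Local Notation S := {mpoly K[n]}.

(** Cycles of the augmented complex: in degree 0 the rows lie in the kernel of the augmentation. In
    [tensor_cycle] degree 0 is unconstrained, since the complex computing Tor omits the
    augmentation. *)
Definition mx_cycle (F : resolution K n) r m : 'M[S]_(r, rk F m) -> Prop :=
  match m with
  | 0 => fun A => forall i, augmentation (row i A) = 0
  | m'.+1 => fun A => A *m bdry F m' = 0
  end.

Lemma lift_mx (F : resolution K n) r m (e : 'I_r -> nat) (A : 'M_(r, rk F m)) :
  hom_mx e (@gdeg _ _ F m) A -> mx_cycle A ->
  exists2 B : 'M_(r, rk F m.+1), hom_mx e (@gdeg _ _ F m.+1) B & A = B *m bdry F m.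
Proof.
move=> hA cA.
have rowB i : exists w : 'rV_(rk F m.+1),
    (forall k, shifted_homog (gdeg k) (e i) (w ord0 k)) /\ row i A = w *m bdry F m.
  have [w wE] : exists w, row i A = w *m bdry F m.
    case: m A hA cA => [|m] A hA cA; first by apply/exact_aug/cA.
    by apply/exact_bdry; rewrite -row_mul cA row0.
  have [|w' hw' w'E] := hom_part_solution (e := e i) (w := w) (@bdry_homog _ _ F m).
    by move=> k; rewrite -wE mxE.
  by exists w'; rewrite wE.
have [w wP] := choice rowB.
exists (\matrix_i w i) => [i k|]; first by rewrite mxE; case: (wP i).
by apply/row_matrixP => i; rewrite row_mul rowK; case: (wP i).
Qed.

Lemma augmentationM (F : resolution K n) r (u : 'rV[S]_r) (A : 'M_(r, rk F 0)) :
  augmentation (u *m A) = \sum_i (u ord0 i)@_0%MM * augmentation (row i A).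
Proof.
rewrite /augmentation; under [RHS]eq_bigr do rewrite mulr_sumr.
rewrite exchange_big; apply: eq_bigr => k _ /=.
rewrite mxE raddf_sum mulr_suml; apply: eq_bigr => i _ /=.
by rewrite rmorphM mxE mulrA.
Qed.

Lemma augmentationB (F : resolution K n) (u w : 'rV_(rk F 0)) :
  augmentation (u - w) = augmentation u - augmentation w.
Proof.
by rewrite /augmentation -sumrB; apply: eq_bigr => i _; rewrite !mxE mcoeffB mulrBl.
Qed.

Lemma augmentation_delta (F : resolution K n) i :
  augmentation (delta_mx 0 i : 'rV_(rk F 0)) = aug i.
Proof.
rewrite /augmentation (bigD1 i) //= mxE !eqxx mcoeff1 eqxx mul1r big1 ?addr0 // => k ki.
by rewrite mxE (negbTE ki) andbF mcoeff0 mul0r.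
Qed.

Lemma augmentation_bdry (F : resolution K n) (w : 'rV_(rk F 1)) :
  augmentation (w *m bdry F 0) = 0.
Proof. by apply/exact_aug; exists w. Qed.

Lemma bdryK (F : resolution K n) m : bdry F m.+1 *m bdry F m = 0.
Proof.
apply/row_matrixP => i; rewrite row_mul row0.
by apply/exact_bdry; exists (delta_mx 0 i); rewrite -rowE.
Qed.

Definition chain_map (F F' : resolution K n)
    (phi : forall m, 'M[S]_(rk F m, rk F' m)) : Prop :=
  [/\ forall i, augmentation (row i (phi 0%N)) = aug i,
      forall m, hom_mx (@gdeg _ _ F m) (@gdeg _ _ F' m) (phi m) &
      forall m, phi m.+1 *m bdry F' m = bdry F m *m phi m].

(** A preimage of [aug i] is truncated to total degree 0. The augmentation is unchanged, as it only
    sees constant coefficients on generators of degree 0. *)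
Lemma aug_lift (F F' : resolution K n) : exists2 phi : 'M[S]_(rk F 0, rk F' 0),
  hom_mx (@gdeg _ _ F 0) (@gdeg _ _ F' 0) phi &
  forall i, augmentation (row i phi) = aug i.
Proof.
have rowP i : exists w : 'rV_(rk F' 0),
    (forall k, shifted_homog (gdeg k) (gdeg i) (w ord0 k)) /\ augmentation w = @aug _ _ F i.
  have [a0|/aug_homog gi] := eqVneq (@aug _ _ F i) 0.
    exists 0; split=> [k|]; first by rewrite mxE; apply/shifted_homogP; exact: supp0.
    by rewrite a0 /augmentation big1 // => k _; rewrite mxE mcoeff0 mul0r.
  have [u uE] := aug_surj F' (@aug _ _ F i).
  exists (\row_k hom_part (gdeg k) 0 (u ord0 k)); split=> [k|].
    by rewrite mxE gi; exact: hom_partP.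
  rewrite -uE; apply: eq_bigr => k _; rewrite mxE.
  have [->|/aug_homog gk] := eqVneq (@aug _ _ F' k) 0; first by rewrite !mulr0.
  congr (_ * _); apply/esym/eqP; rewrite -subr_eq0 -mcoeffB mcoeff_eq0; apply/negP.
  by move/hom_part_rest; rewrite gk mdeg0.
have [w wP] := choice rowP.
exists (\matrix_i w i) => [i k|i]; first by rewrite mxE; case: (wP i).
by rewrite rowK; case: (wP i).
Qed.

(** The comparison theorem for free resolutions. The invariant of the construction is that
    [bdry F m *m phi] consists of cycles, which is what the next lift requires. *)
Lemma chain_map_exists (F F' : resolution K n) : exists phi, @chain_map F F' phi.
Proof.
have [||phi [phi_aug phiP phi_bdry]] := @dep_nat_choice
  (fun m => 'M[S]_(rk F m, rk F' m))
  (fun m phi => hom_mx (@gdeg _ _ F m) (@gdeg _ _ F' m) phi /\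
     mx_cycle (bdry F m *m phi))
  (fun m phi phi' => phi' *m bdry F' m = bdry F m *m phi)
  (fun phi => forall i, augmentation (row i phi) = @aug _ _ F i); last 1 first.
- by exists phi; split=> // m; case: (phiP m).
- have [phi hphi phi_aug] := aug_lift F F'; exists phi => //; split=> // i /=.
  rewrite row_mul augmentationM -[RHS](augmentation_bdry (delta_mx 0 i)) -rowE.
  by apply: eq_bigr => k _; rewrite phi_aug.
- move=> m phi [hphi cphi].
  have [phi' hphi' phi'E] := lift_mx (hom_mxM (@bdry_homog _ _ F m) hphi) cphi.
  exists phi'; last exact/esym; split=> //=.
  by rewrite -mulmxA -phi'E mulmxA bdryK mul0mx.
Qed.

(** A graded chain endomorphism inducing 0 on K is null-homotopic. The invariant is that G minus the
    part already produced by h consists of cycles. *)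
Lemma homotopy_exists (F : resolution K n) (G : forall m, 'M[S]_(rk F m)) :
  (forall i, augmentation (row i (G 0%N)) = 0) ->
  (forall m, hom_mx (@gdeg _ _ F m) (@gdeg _ _ F m) (G m)) ->
  (forall m, G m.+1 *m bdry F m = bdry F m *m G m) ->
  exists h : forall m, 'M[S]_(rk F m, rk F m.+1),
    [/\ h 0%N *m bdry F 0 = G 0%N,
        forall m, hom_mx (@gdeg _ _ F m) (@gdeg _ _ F m.+1) (h m) &
        forall m, h m.+1 *m bdry F m.+1 = G m.+1 - bdry F m *m h m].
Proof.
move=> G0 hG Gd.
have [||h [h0 hP hS]] := @dep_nat_choice
  (fun m => 'M[S]_(rk F m, rk F m.+1))
  (fun m h => hom_mx (@gdeg _ _ F m) (@gdeg _ _ F m.+1) h /\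
     (G m.+1 - bdry F m *m h) *m bdry F m = 0)
  (fun m h h' => h' *m bdry F m.+1 = G m.+1 - bdry F m *m h)
  (fun h => h *m bdry F 0 = G 0%N); last 1 first.
- by exists h; split=> // m; case: (hP m).
- have [h hh hE] := @lift_mx F _ 0 _ _ (hG 0%N) G0.
  by exists h => //; split=> //; rewrite mulmxBl Gd -mulmxA -hE subrr.
- move=> m h [hh ch].
  have hGh := hom_mxB (hG _) (hom_mxM (@bdry_homog _ _ F m) hh).
  have [h' hh' h'E] := @lift_mx F _ m.+1 _ _ hGh ch.
  exists h' => //; split=> //.
  rewrite mulmxBl Gd -mulmxA -h'E mulmxBr opprB addrCA subrr addr0.
  by rewrite mulmxA bdryK mul0mx.
Qed.

Variable I : S -> Prop.
Hypothesis I0 : I 0.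
Hypothesis ID : forall p q, I p -> I q -> I (p + q).
Hypothesis IM : forall p q, I p -> I (p * q).

Definition tor_vanish (F : resolution K n) m j : Prop :=
  forall u : 'rV[S]_(rk F m), tensor_chain I j u -> tensor_cycle u ->
  exists2 w, tensor_chain I j w & u = w *m bdry F m.

Lemma tensor_chainM (F F' : resolution K n) m m' j (u : 'rV_(rk F m))
    (A : 'M_(rk F m, rk F' m')) :
  hom_mx (@gdeg _ _ F m) (@gdeg _ _ F' m') A ->
  tensor_chain I j u -> tensor_chain I j (u *m A).
Proof.
move=> hA cu i; rewrite mxE; split.
  elim/big_ind: _ => // k _; apply: IM; by case: (cu k).
by apply: shifted_homog_sum => k; apply: shifted_homogM (hA k i); case: (cu k).
Qed.

Lemma tensor_chainD (F : resolution K n) m j (u w : 'rV_(rk F m)) :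
  tensor_chain I j u -> tensor_chain I j w -> tensor_chain I j (u + w).
Proof.
move=> cu cw i; have [Iu hu] := cu i; have [Iw hw] := cw i.
rewrite mxE; split; first exact: ID.
by apply/shifted_homogP; apply: suppD; apply/shifted_homogP.
Qed.

(** A cycle of F is carried to F' by phi, bounded there, and carried back by psi; a homotopy between
    1 and phi psi supplies the rest. Entries stay in I because I absorbs products. *)
Lemma tor_vanish_indep (F F' : resolution K n) m j :
  tor_vanish F' m j -> tor_vanish F m j.
Proof.
move=> van u cu zu.
have [phi [phi_aug hphi phi_bdry]] := chain_map_exists F F'.
have [psi [psi_aug hpsi psi_bdry]] := chain_map_exists F' F.
have [||m'|h [h0 hh hS]] := @homotopy_exists F (fun m => 1%:M - phi m *m psi m).
- move=> i; have -> : row i (1%:M - phi 0%N *m psi 0%N) =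
      delta_mx 0 i - row i (phi 0%N) *m psi 0%N by rewrite !rowE mulmxBr mulmx1 mulmxA.
  rewrite augmentationB augmentationM (eq_bigr _ (fun k _ => congr1 _ (psi_aug k))).
  by rewrite augmentation_delta -[X in _ - X]/(augmentation (row i (phi 0%N))) phi_aug subrr.
- by move=> m'; apply: hom_mxB; [exact: hom_mx1 | exact: hom_mxM].
- by rewrite mulmxBl mulmxBr mul1mx mulmx1 -mulmxA psi_bdry mulmxA phi_bdry -mulmxA.
have [|w cw wE] := van (u *m phi m) (tensor_chainM (hphi m) cu).
  case: m u {cu van} zu => [//|m] u /= zu.
  by rewrite -mulmxA phi_bdry mulmxA zu mul0mx.
exists (u *m h m + w *m psi m.+1).
  by apply: tensor_chainD; [exact: tensor_chainM cu | exact: tensor_chainM cw].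
have hu : u *m h m *m bdry F m = u *m (1%:M - phi m *m psi m).
  case: m u zu {cu w cw wE van} => [|m] u /= zu; first by rewrite -mulmxA h0.
  by rewrite -mulmxA hS mulmxBr (mulmxA u (bdry _ _)) zu mul0mx subr0.
rewrite mulmxDl hu -mulmxA psi_bdry mulmxA -wE mulmxBr mulmx1 mulmxA.
by rewrite subrK.
Qed.
End Comparison.

(** * Regularity of ideals of edges and variables *)

Section KoszulRegularity.
Variables (K : fieldType) (n : nat) (v : nat -> 'I_n).
Implicit Types (E B C : 'X_{1..n} -> Prop).

(* Homology in homological degree m with entries of degree t + 1 has internal
   degree m + t + 1; entries of degree t in homological degree m + 1 have the same
   internal degree.  So r bounds j - m on the nonzero Tor_m in degree j. *)
Definition koszul_reg_le k E r : Prop := forall t, (r <= t)%N ->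
  koszul_vanish K v k (fun m => E m /\ mdeg m = t.+1) (fun m => E m /\ mdeg m = t).

Lemma koszul_vanishW k B B' C C' : (forall m, B' m -> B m) -> (forall m, C m -> C' m) ->
  koszul_vanish K v k B C -> koszul_vanish K v k B' C'.
Proof.
move=> sB sC van m u su cu; have [|w sw wE] := van m u _ cu; first exact: rsuppW su.
by exists w => //; apply: rsuppW sw.
Qed.

Lemma koszul_vanish_empty k B C : (forall m, ~ B m) -> koszul_vanish K v k B C.
Proof.
move=> noB m u su _; rewrite (rsupp_eq0 noB su); exists 0; first exact: rsupp0.
by rewrite mul0mx.
Qed.

Lemma koszul_reg_leW k E E' r r' : (r <= r')%N -> (forall m, E m <-> E' m) ->
  koszul_reg_le k E r -> koszul_reg_le k E' r'.
Proof.
move=> rr' EE' reg t r't; apply: koszul_vanishW (reg t (leq_trans rr' r't)) => m [/EE'] //.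
Qed.

Lemma koszul_reg_le_empty k E r : (forall m, ~ E m) -> koszul_reg_le k E r.
Proof. by move=> noE t _; apply: koszul_vanish_empty => m [/noE]. Qed.

Section Step.
Variables (k : nat) (E E0 : 'X_{1..n} -> Prop).
Let x := v k.
Hypothesis vx : forall i, (i < k)%N -> v i != x.
Hypothesis EX : forall m, E m -> E (m + U_(x))%MM.
Hypothesis E_kill : forall m, E m /\ m x = 0%N <-> E0 m.

Let mdegX m : mdeg (m + U_(x))%MM = (mdeg m).+1.
Proof. by rewrite mdegD mdeg1 addn1. Qed.

(** As (E : x) = E, the null-homotopy of x bounds the colon part of a cycle, and only the ideal with
    x set to 0 contributes. *)
Lemma koszul_reg_le_colon_self r : (forall m, E (m + U_(x))%MM -> E m) ->
  koszul_reg_le k E0 r -> koszul_reg_le k.+1 E r.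
Proof.
move=> colonE reg t rt; apply: koszul_vanish_step => //.
- by move=> m [Em <-] mx; split; [exact: EX | exact: mdegX].
- by apply: koszul_vanishW (reg t rt) => m; rewrite -E_kill; tauto.
- by right=> m [/colonE Em]; rewrite mdegX => -[].
Qed.

(** The colon part of a cycle enters multiplied by x, which raises the degree of entries by one:
    hence r for the colon ideal against r + 1. *)
Lemma koszul_reg_le_colon r E1 : (forall m, E (m + U_(x))%MM <-> E1 m) ->
  koszul_reg_le k E0 r.+1 -> koszul_reg_le k.+1 E1 r -> koszul_reg_le k.+1 E r.+1.
Proof.
move=> colonE reg regc [|t] // rt; apply: koszul_vanish_step => //.
- by move=> m [Em <-] mx; split; [exact: EX | exact: mdegX].
- by apply: koszul_vanishW (reg _ rt) => m; rewrite -E_kill; tauto.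
- left; apply: koszul_vanishW (regc t rt) => m; rewrite -colonE mdegX; first by move=> [? []].
  by move=> [? ->].
Qed.
End Step.

(* The monomials in the variables v 0, ..., v (k-1). *)
Definition in_prefix k (m : 'X_{1..n}) : Prop :=
  forall y, m y != 0%N -> exists2 i, (i < k)%N & v i = y.

Lemma in_prefixS k (m : 'X_{1..n}) : in_prefix k m -> in_prefix k.+1 m.
Proof. by move=> mk y /mk[i ik <-]; exists i => //; rewrite ltnS ltnW. Qed.

Lemma in_prefixX k (m : 'X_{1..n}) : in_prefix k.+1 (m + U_(v k))%MM <-> in_prefix k.+1 m.
Proof.
split=> mk y my; first by apply: mk; rewrite mnmDE addn_eq0 (negbTE my).
move: my; rewrite mnmDE mnm1E; have [<- _|_] := eqVneq (v k) y; first by exists k.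
by rewrite addn0 => /mk.
Qed.

Lemma in_prefix_kill k (m : 'X_{1..n}) : (forall i, (i < k)%N -> v i != v k) ->
  in_prefix k m <-> in_prefix k.+1 m /\ m (v k) = 0%N.
Proof.
move=> vk; split=> [mk|[mk m0] y my].
  split; first exact: in_prefixS.
  by apply/eqP/negPn/negP => /mk[i /vk /eqP].
have [i] := mk y my; rewrite ltnS leq_eqVlt => /orP[/eqP -> vky|ik <-]; last by exists i.
by rewrite -vky m0 in my.
Qed.

(** This is regularity 0 of the unit ideal: it equals its colon by each variable, and with no
    variables there is no monomial of positive degree. *)
Lemma koszul_reg_le_prefix k : (forall i j, (i < j < k)%N -> v i != v j) ->
  koszul_reg_le k (in_prefix k) 0.
Proof.
elim: k => [|k IH] vP.
  move=> t _; apply: koszul_vanish_empty => m [m0].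
  rewrite (_ : m = 0%MM) ?mdeg0 //; apply/mnmP => y; rewrite mnm0E.
  by apply/eqP/negPn/negP => /m0[].
have vk i : (i < k)%N -> v i != v k by move=> ik; rewrite vP // ik ltnSn.
apply: (@koszul_reg_le_colon_self k _ (in_prefix k)) => //.
- by move=> m; rewrite in_prefixX.
- by move=> m; rewrite -in_prefix_kill.
- by move=> m; rewrite in_prefixX.
- by apply: IH => i j /andP[ij jk]; rewrite vP // ij ltnW.
Qed.

(** * Edge ideals enlarged by variables *)

Variable e : rel 'I_n.

Definition edge_monomial (m : 'X_{1..n}) : Prop :=
  exists i j, [/\ e i j, m i != 0%N & m j != 0%N].

(* The monomials in v 0, ..., v (k-1) of the ideal generated by the edges and by
   the variables v a, ..., v (b-1). *)
Definition extended_edge_monomial a b k m : Prop :=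
  in_prefix k m /\
  ((exists2 i, (a <= i < b)%N & m (v i) != 0%N) \/ edge_monomial m).

Local Notation M := extended_edge_monomial.

Lemma mnmX_neq0 (m : 'X_{1..n}) x y : m y != 0%N -> (m + U_(x))%MM y != 0%N.
Proof. by move=> my; rewrite mnmDE addn_eq0 (negbTE my). Qed.

Lemma extended_edgeX a b k m : M a b k.+1 m -> M a b k.+1 (m + U_(v k))%MM.
Proof.
move=> [mk me]; split; first exact/in_prefixX.
case: me => [[i ab mi]|[i [j [eij mi mj]]]]; first by left; exists i => //; exact: mnmX_neq0.
by right; exists i, j; split => //; exact: mnmX_neq0.
Qed.

Section EdgeSteps.
Variables (a k : nat) (r : nat).
Hypothesis v_inj : forall i j, (i < j < k.+1)%N -> v i != v j.

Let vk i : (i < k)%N -> v i != v k.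
Proof. by move=> ik; rewrite v_inj // ik ltnSn. Qed.

(** Setting the new generator [v k] to 0 gives back the previous ideal, and the colon by [v k] is
    the whole ring, of regularity 0. *)
Lemma koszul_reg_le_add_var : (a <= k)%N ->
  koszul_reg_le k (M a k k) r.+1 -> koszul_reg_le k.+1 (M a k.+1 k.+1) r.+1.
Proof.
move=> ak reg; apply: koszul_reg_le_colon reg _ => //.
- exact: extended_edgeX.
- move=> m; split=> [[[mk me] m0]|[mk me]].
    split; first exact/in_prefix_kill.
    case: me => [[i /andP[ai]]|]; last by right.
    rewrite ltnS leq_eqVlt => /orP[/eqP ->|ik mi]; first by rewrite m0.
    by left; exists i => //; rewrite ai.
  have [mk' m0] := proj1 (in_prefix_kill _ vk) mk; split=> //; split=> //.
  case: me => [[i /andP[ai ik] mi]|]; last by right.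
  by left; exists i => //; rewrite ai ltnS ltnW.
- move=> m; split=> [[/in_prefixX mk _]|mk]; first exact: mk.
  split; first exact/in_prefixX.
  by left; exists k; rewrite ?ak ?ltnSn // mnmDE mnm1E eqxx addn1.
- exact: koszul_reg_leW (leq0n r) _ (koszul_reg_le_prefix v_inj).
Qed.

Hypothesis e_sym : ssrbool.symmetric e.
Hypothesis e_irr : irreflexive e.
Hypothesis nbrs : forall i, (i < k)%N -> e (v k) (v i) = (a <= i)%N.

Lemma nbr_edge m i : in_prefix k.+1 m -> e (v k) i -> m i != 0%N ->
  exists2 j, (a <= j < k)%N & m (v j) != 0%N.
Proof.
move=> mk eki mi; have [j] := mk i mi.
rewrite ltnS leq_eqVlt => /orP[/eqP -> vki|jk vji]; last first.
  by exists j; rewrite ?vji // jk -nbrs // vji eki.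
by move: eki; rewrite -vki e_irr.
Qed.

(** An edge dividing m times [v k] either divides m or ends at [v k]; in the latter case its other
    end is a neighbour dividing m. *)
Lemma edge_monomialX m : in_prefix k.+1 m -> edge_monomial (m + U_(v k))%MM ->
  (exists2 j, (a <= j < k)%N & m (v j) != 0%N) \/ edge_monomial m.
Proof.
move=> mk [i [j [eij]]]; rewrite !mnmDE !mnm1E.
have [iE|ik] := eqVneq (v k) i; have [jE|jk] := eqVneq (v k) j; rewrite ?addn0.
- by rewrite -iE -jE e_irr in eij.
- by move=> _ mj; left; apply: nbr_edge mk _ mj; rewrite iE.
- by move=> mi _; left; apply: nbr_edge mk _ mi; rewrite jE e_sym.
- by move=> mi mj; right; exists i, j.
Qed.

(** [M k k k.+1] is the plain edge ideal, its range of added variables being empty. Its colon by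
    [v k] adds the neighbours [v a], ..., [v (k-1)], and setting [v k] to 0 deletes the vertex. *)
Lemma koszul_reg_le_add_vertex :
  koszul_reg_le k (M k k k) r.+1 -> koszul_reg_le k (M a k k) r ->
  koszul_reg_le k.+1 (M k k k.+1) r.+1.
Proof.
move=> reg regN.
have killM a' m : M a' k k.+1 m /\ m (v k) = 0%N <-> M a' k k m.
  by have := in_prefix_kill m vk; rewrite /extended_edge_monomial; tauto.
apply: (koszul_reg_le_colon (E1 := M a k k.+1) _ _ _ _ reg) => //.
- exact: extended_edgeX.
- move=> m; split=> [[/in_prefixX mk [[i]|me]]|[mk me]].
  + by case: ltngtP.
  + by split=> //; exact: edge_monomialX.
  split; first exact/in_prefixX.
  right; case: me => [[i /andP[ai ik] mi]|[i [j [eij mi mj]]]].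
    exists (v k), (v i); split; first by rewrite nbrs.
      by rewrite mnmDE mnm1E eqxx addn1.
    exact: mnmX_neq0.
  by exists i, j; split=> //; exact: mnmX_neq0.
(* Edges at [v k] are multiples of neighbours already in the colon ideal, so that ideal equals its
   own colon by [v k] and restricts to the first k variables. *)
apply: koszul_reg_le_colon_self regN => //; first exact: extended_edgeX.
move=> m [/in_prefixX mk [[i aik mi]|me]]; split=> //; last exact: edge_monomialX.
have ik : (i < k)%N by case/andP: aik.
move: mi; rewrite mnmDE mnm1E [v k == _]eq_sym (negbTE (vk ik)) addn0.
by move=> mi; left; exists i.
Qed.
End EdgeSteps.

Lemma koszul_reg_le_add_vars a k r : (a <= k)%N ->
  (forall i j, (i < j < k)%N -> v i != v j) ->
  koszul_reg_le a (M a a a) r.+1 -> koszul_reg_le k (M a k k) r.+1.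
Proof.
move=> ak v_inj reg; elim: k ak v_inj => [|k IH]; first by case: a reg.
rewrite leq_eqVlt => /orP[/eqP <- //|ak] v_inj.
apply: koszul_reg_le_add_var => //; apply: IH => // i j /andP[ij jk].
by rewrite v_inj // ij ltnW.
Qed.

End KoszulRegularity.

(** * Passing to a polynomial ring in fewer variables *)

Lemma push_monomial_neq0 n n' (h : 'I_n -> option 'I_n') (m : 'X_{1..n}) j :
  push_monomial h m j != 0%N <-> exists2 i, h i = Some j & m i != 0%N.
Proof.
rewrite mnmE sum_nat_eq0 negb_forall; split=> [/existsP[i]|[i hi mi]].
  by rewrite negb_imply => /andP[/eqP hi mi]; exists i.
by apply/existsP; exists i; rewrite hi eqxx.
Qed.

Lemma mdeg_push_monomial n n' (h : 'I_n -> option 'I_n') (m : 'X_{1..n}) :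
  (forall i, m i != 0%N -> h i) -> mdeg (push_monomial h m) = mdeg m.
Proof.
move=> hm; rewrite !mdegE; under eq_bigr do rewrite mnmE.
rewrite (exchange_big_dep predT) //=; apply: eq_bigr => i _.
have [->|/hm] := eqVneq (m i) 0%N; first by rewrite big1.
by case: (h i) => [j _|//]; rewrite (big_pred1 j) // => j'; rewrite [RHS]eq_sym.
Qed.

Section RingChange.
Variables (K : fieldType) (n n' : nat) (v : nat -> 'I_n) (v' : nat -> 'I_n').
Variables (e : rel 'I_n) (e' : rel 'I_n') (iota : 'I_n' -> 'I_n).
Hypothesis iota_inj : injective iota.
Hypothesis iota_v : forall i, (i < n')%N -> v i = iota (v' i).
Hypothesis v'_surj : forall y, exists2 i, (i < n')%N & v' i = y.
Hypothesis iota_e : forall i j, e (iota i) (iota j) = e' i j.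

Let retr (i : 'I_n) : option 'I_n' := [pick j | iota j == i].

Let retr_iota j : retr (iota j) = Some j.
Proof.
rewrite /retr; case: pickP => [j' /eqP/iota_inj -> //|/(_ j)].
by rewrite eqxx.
Qed.

Let retrP i j : retr i = Some j -> iota j = i.
Proof. by rewrite /retr; case: pickP => // j' /eqP <- [->]. Qed.

Let in_prefix_iota m i : in_prefix v n' m -> m i != 0%N -> exists j, iota j = i.
Proof. by move=> mk /mk[a an' <-]; exists (v' a); rewrite iota_v. Qed.

(** All monomials of the ideal lie in the first n' variables, so a cycle is moved to the smaller
    ring by [rho], bounded there, and the bounding chain is moved back by [emb]. *)
Lemma koszul_reg_le_embed r :
  koszul_reg_le K v' n' (edge_monomial e') r ->
  koszul_reg_le K v n' (extended_edge_monomial v e n' n' n') r.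
Proof.
move=> reg t rt m u su cu.
pose rho := @var_subst K n n' retr; pose emb := @var_subst K n' n (Some \o iota).
have rhoX i : (i < n')%N -> rho (kvar K v i) = kvar K v' i.
  by move=> ii; rewrite /rho /kvar var_substU /subst_var iota_v // retr_iota.
have embX i : (i < n')%N -> emb (kvar K v' i) = kvar K v i.
  by move=> ii; rewrite /emb /kvar var_substU /subst_var /= iota_v.
have uE : u = map_mx emb (map_mx rho u).
  apply/rowP => i; rewrite !mxE; apply/esym/var_subst_comp_id.
  apply: suppW (su i) => m0 [[mk _] _] y /(in_prefix_iota mk)[j <-].
  by exists j; rewrite ?retr_iota.
have [||w sw wE] := reg t rt m (map_mx rho u).
- move=> i; rewrite mxE; apply: var_subst_supp (su i) => m0 [[mk me] mt] hm0.
  split; last by rewrite mdeg_push_monomial.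
  case: me => [[a]|[i1 [i2 [e12 m1 m2]]]]; first by case: ltngtP.
  have [j1 i1E] := in_prefix_iota mk m1; have [j2 i2E] := in_prefix_iota mk m2.
  exists j1, j2; split; first by rewrite -iota_e i1E i2E.
    by apply/push_monomial_neq0; exists i1; rewrite // -i1E retr_iota.
  by apply/push_monomial_neq0; exists i2; rewrite // -i2E retr_iota.
- by rewrite -(map_kdiff m rhoX) -map_mxM cu map_mx0.
exists (map_mx emb w); last by rewrite [LHS]uE wE map_mxM (map_koszul m embX).
move=> i; rewrite mxE; apply: var_subst_supp (sw i) => m0 [[j1 [j2 [e12 m1 m2]]] mt] _.
have push_iota j : m0 j != 0%N -> push_monomial (Some \o iota) m0 (iota j) != 0%N.
  by move=> mj; apply/push_monomial_neq0; exists j.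
split; last by rewrite mdeg_push_monomial.
split.
  move=> y /push_monomial_neq0[j [<-] _]; have [a an' <-] := v'_surj j.
  by exists a; rewrite ?iota_v.
by right; exists (iota j1), (iota j2); rewrite iota_e e12; split=> //; exact: push_iota.
Qed.
End RingChange.

(** * Koszul bounds and the regularity of the edge ideal *)

Section EdgeIdealKoszul.
Variables (K : fieldType) (G : sgraph).
Local Notation S := {mpoly K[#|G|]}.

Definition edge_rel : rel 'I_#|G| := fun i j => sedge (enum_val i) (enum_val j).

Lemma edge_ideal0 : @edge_ideal K G 0.
Proof.
exists (fun _ _ => 0); rewrite big1 // => x _; rewrite big1 // => y _.
by rewrite mul0r.
Qed.

Lemma edge_idealD p q : @edge_ideal K G p -> edge_ideal q -> edge_ideal (p + q).
Proof.
move=> [c ->] [d ->]; exists (fun x y => c x y + d x y).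
rewrite -big_split; apply: eq_bigr => x _; rewrite -big_split; apply: eq_bigr => y _.
by rewrite /= mulrDl.
Qed.

Lemma edge_idealM p q : @edge_ideal K G p -> edge_ideal (p * q).
Proof.
move=> [c ->]; exists (fun x y => q * c x y).
rewrite mulrC mulr_sumr; apply: eq_bigr => x _; rewrite mulr_sumr; apply: eq_bigr => y _.
exact: mulrA.
Qed.

Lemma edge_idealP (p : S) : edge_ideal p <-> supp (edge_monomial edge_rel) p.
Proof.
split=> [[c ->]|sp].
  apply: supp_sum => x _; apply: supp_sum => y xy.
  rewrite -mpolyXD; pose xy_mon := (U_(enum_rank x) + U_(enum_rank y))%MM.
  apply: (@suppM _ _ (fun=> True) (eq xy_mon)) => //.
    move=> m m' _ <-; exists (enum_rank x), (enum_rank y).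
    rewrite /edge_rel !enum_rankK xy !mnmDE !mnm1E !eqxx.
    by split=> //; rewrite -lt0n ?addnA ?addn1 // addnAC addn1.
  exact/suppX.
rewrite [p]mpolyE big_seq; apply: big_ind => [||m /sp].
- exact: edge_ideal0.
- exact: edge_idealD.
case=> i [j [eij mi mj]].
rewrite -mul_mpolyC mulrC; apply: edge_idealM.
(* Since i and j differ, nonzero exponents at both suffice for x_i x_j to divide the monomial. *)
have ij : i != j by apply/eqP => ij; rewrite /edge_rel ij sedge_irr in eij.
have -> : 'X_[m] = ('X_i * 'X_j) * 'X_[m - U_(i) - U_(j)] :> S.
  rewrite -!mpolyXD; congr 'X_[_]; apply/mnmP => y.
  rewrite !mnmDE !mnmBE !mnm1E; case: (eqVneq i y) (eqVneq j y) => [<-|_] [jy|_] /=.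
  - by rewrite jy eqxx in ij.
  - by rewrite subn0 subnKC // lt0n.
  - by rewrite -jy subn0 subnKC // lt0n.
  - by rewrite !subn0.
apply: edge_idealM.
exists (fun x y => ((x == enum_val i) && (y == enum_val j))%:R).
rewrite (bigD1 (enum_val i)) //= (bigD1 (enum_val j)) //= !eqxx mul1r.
rewrite /var !enum_valK big1 => [|y /andP[_ /negbTE ->]]; last by rewrite mul0r.
rewrite addr0 big1 ?addr0 // => x /negbTE xi; rewrite big1 // => y _.
by rewrite xi mul0r.
Qed.

Variable v : nat -> 'I_#|G|.
Hypothesis v_inj : forall i j, (i < j < #|G|)%N -> v i != v j.
Hypothesis v_surj : forall y, exists2 i, (i < #|G|)%N & v i = y.

Local Notation F := (koszul_resolution K v_inj v_surj).

Lemma koszul_chainP m s (u : 'rV[S]_(rk F m)) :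
  tensor_chain (@edge_ideal K G) (m + s) u <->
  rsupp (fun mm => edge_monomial edge_rel mm /\ mdeg mm = s) u.
Proof.
split=> su i.
  have [/edge_idealP se /shifted_homogP sh] := su i => mm mu; split; first exact: se.
  by apply/eqP; rewrite -(eqn_add2l m); apply/eqP; exact: sh.
split; first by apply/edge_idealP; apply: suppW (su i) => ? [].
by apply/shifted_homogP; apply: suppW (su i) => mm [_ ->].
Qed.

Lemma koszul_cycleP m (u : 'rV[S]_(rk F m)) :
  tensor_cycle u <-> u *m kdiff (kvar K v) #|G| m = 0.
Proof.
case: m u => [|m] u; last by [].
by split=> // _; apply/rowP; case.
Qed.

(** [Tor_neq0] may be witnessed on any resolution, so vanishing on the Koszul one is transported by
    [tor_vanish_indep]. Entries of degree t + 1 correspond to j = m + t + 1. *)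
Lemma koszul_reg_le_tor r : koszul_reg_le K v #|G| (edge_monomial edge_rel) r ->
  forall m j, (m + r < j)%N -> ~ Tor_neq0 (@edge_ideal K G) m j.
Proof.
move=> reg m j mrj [F' [u [cu zu nu]]]; apply: nu.
have van : tor_vanish (@edge_ideal K G) F m j.
  move=> u' cu' /koszul_cycleP zu'.
  have jE : j = (m + (j - m).-1.+1)%N.
    have mj : (m < j)%N by exact: leq_ltn_trans (leq_addr _ _) mrj.
    by rewrite prednK ?subnKC ?subn_gt0 // ltnW.
  move: (j - m).-1 jE => t jE; rewrite jE in cu' *.
  have rt : (r <= t)%N by rewrite jE addnS ltnS leq_add2l in mrj.
  have [w sw wE] := reg t rt m u' (proj1 (koszul_chainP _ _) cu') zu'.
  by exists w => //; rewrite -addSnnS; exact/koszul_chainP.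
have [w cw wE] := tor_vanish_indep edge_ideal0 edge_idealD edge_idealM (F := F') van cu zu.
by exists w.
Qed.

Lemma tor_koszul_reg_le r :
  (forall m j, (m + r < j)%N -> ~ Tor_neq0 (@edge_ideal K G) m j) ->
  koszul_reg_le K v #|G| (edge_monomial edge_rel) r.
Proof.
move=> noTor t rt m u su cu; apply: contrapT => nu.
apply: (noTor m (m + t.+1)%N); first by rewrite addnS ltnS leq_add2l.
exists F, u; split; [exact/koszul_chainP | exact/koszul_cycleP |].
move=> [w [cw wE]]; apply: nu; exists w => //.
by apply/(@koszul_chainP m.+1); rewrite addSnnS.
Qed.

Variable R : realType.

(** The differences j - m are integers, so a real bound c may be replaced by its floor. For an
    edgeless graph the value 2 is a convention, but the ideal is 0 and every Koszul bound holds. *)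
Lemma reg_koszul_le (c : R) : 0 <= c -> (reg_edge_ideal K G R <= c%:E)%E ->
  koszul_reg_le K v #|G| (edge_monomial edge_rel) (Num.truncn c).
Proof.
move=> c0; rewrite /reg_edge_ideal; case: asboolP => [noE _|_ regc].
  apply: koszul_reg_le_empty => m [i [j [eij _ _]]].
  by move: eij; apply/negP/noE.
apply: tor_koszul_reg_le => m j mj torN.
have /le_trans/(_ regc) : ((j%:R - m%:R)%:E <= reg (@edge_ideal K G) R)%E.
  by apply: ereal_sup_ubound; exists m, j.
rewrite lee_fin leNgt => /negP; apply; rewrite ltrBrDl.
have /andP[_ cS] := truncn_itv c0.
apply: lt_le_trans (_ : m%:R + (Num.truncn c).+1%:R <= _); first by rewrite ltrD2l.
by rewrite -natrD ler_nat addnS.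
Qed.

Lemma koszul_le_reg (c : R) r : r%:R <= c -> 2 <= c ->
  koszul_reg_le K v #|G| (edge_monomial edge_rel) r ->
  (reg_edge_ideal K G R <= c%:E)%E.
Proof.
move=> rc c2 reg; rewrite /reg_edge_ideal; case: asboolP => [_|_]; first by rewrite lee_fin.
apply: ge_ereal_sup => _ [m [j [torN ->]]]; rewrite lee_fin.
apply: le_trans rc; rewrite lerBlDl -natrD ler_nat leqNgt; apply/negP => mrj.
exact: koszul_reg_le_tor reg _ _ mrj torN.
Qed.
End EdgeIdealKoszul.

(** * Deleting a vertex and its star *)

Section VertexDeletion.
Variable G : sgraph.

Lemma card_delete (D : {set G}) : #|delete D| = (#|G| - #|D|)%N.
Proof.
have -> : (#|G| - #|D|)%N = #|~: D| by rewrite [RHS]cardsCs setCK.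
rewrite /delete /= card_sig; by apply: eq_card => y; rewrite !inE.
Qed.

Lemma card_star (x : G) : #|star x| = (degree x).+1.
Proof. by rewrite /star setUC cardsU1 inE sedge_irr. Qed.

(* The vertices outside st x come first, then the neighbours of x, then x. *)
Definition star_last_enum (x : G) (v : nat -> 'I_#|G|) : Prop :=
  [/\ forall i j, (i < j < #|G|)%N -> v i != v j,
      forall y, exists2 i, (i < #|G|)%N & v i = y,
      v #|G|.-1 = enum_rank x &
      forall y, y \notin star x <->
        exists2 i, (i < #|delete (star x)|)%N & v i = enum_rank y].

Lemma star_last_enum_exists (x : G) : exists v, star_last_enum x v.
Proof.
pose zs := enum (~: star x); pose ys := enum (star x :\ x).
pose s := rcons (zs ++ ys) x.
have x_star : x \in star x by rewrite !inE eqxx orbT.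
have s_uniq : uniq s.
  rewrite rcons_uniq mem_cat !mem_enum !inE eqxx orbT /= cat_uniq !enum_uniq andbT /=.
  by apply/hasPn => y; rewrite !mem_enum in_setD1 in_setC => /andP[_ ->].
have s_all y : y \in s.
  rewrite mem_rcons inE mem_cat !mem_enum in_setC in_setD1.
  by case: (y == x); case: (y \in star x).
have s_size : size s = #|G|.
  rewrite cardT; apply/perm_size/uniq_perm; rewrite ?enum_uniq // => y.
  by rewrite s_all mem_enum.
have zs_size : #|delete (star x)| = size zs.
  by rewrite card_delete -cardE [RHS]cardsCs setCK.
exists (fun i => enum_rank (nth x s i)); split.
- move=> i j /andP[ij jn]; rewrite (inj_eq enum_rank_inj) nth_uniq ?s_size ?(ltn_trans ij) //.
  by rewrite neq_ltn ij.
- move=> y; exists (index (enum_val y) s); first by rewrite -s_size index_mem.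
  by rewrite nth_index // enum_valK.
- congr enum_rank; have -> : #|G|.-1 = size (zs ++ ys) by rewrite -s_size size_rcons.
  by rewrite nth_rcons ltnn eqxx.
have nth_zs i : (i < size zs)%N -> nth x s i = nth x zs i.
  by move=> iz; rewrite nth_rcons size_cat ltn_addr // nth_cat iz.
rewrite zs_size => y; split=> [yN|[i iz /enum_rank_inj]].
  have yz : y \in zs by rewrite mem_enum inE.
  by exists (index y zs); rewrite ?index_mem // nth_zs ?index_mem // nth_index.
by rewrite nth_zs // => <-; have := mem_nth x iz; rewrite mem_enum inE.
Qed.

Variables (K : fieldType) (v : nat -> 'I_#|G|).
Hypothesis v_inj : forall i j, (i < j < #|G|)%N -> v i != v j.

(** The first k variables are the vertices outside D, and the edges among them are those of G - D;
    [koszul_reg_le_embed] then applies after renumbering. *)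
Lemma koszul_reg_le_delete (D : {set G}) r k : k = #|delete D| ->
  (forall y, y \notin D <-> exists2 i, (i < k)%N & v i = enum_rank y) ->
  (forall v' : nat -> 'I_#|delete D|,
     (forall i j, (i < j < #|delete D|)%N -> v' i != v' j) ->
     (forall y, exists2 i, (i < #|delete D|)%N & v' i = y) ->
     koszul_reg_le K v' #|delete D| (edge_monomial (edge_rel (G := delete D))) r) ->
  koszul_reg_le K v k (extended_edge_monomial v (edge_rel (G := G)) k k k) r.
Proof.
(* The case of no remaining vertex is separate because [insubd] needs a default vertex. *)
move=> kE vD reg; case: (pickP (fun _ : delete D => true)) => [y0 _|noH]; last first.
  have k0 : k = 0%N.
    rewrite kE; apply/eqP; rewrite -cardsT cards_eq0.
    by apply/eqP/setP => y; have := noH y.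
  apply: koszul_reg_le_empty => m [mk [[i]|[i [_ [_ mi _]]]]]; first by rewrite k0.
  by have [a] := mk i mi; rewrite k0.
subst k; set k := #|delete D| in vD *.
pose v' i : 'I_#|delete D| := enum_rank (insubd y0 (enum_val (v i)) : delete D).
pose iota (j : 'I_#|delete D|) : 'I_#|G| := enum_rank (val (enum_val j : delete D)).
have vE i : (i < k)%N -> v i = iota (v' i).
  move=> ik; rewrite /iota /v' enum_rankK val_insubd ifT ?enum_valK //.
  by apply/vD; exists i; rewrite ?enum_valK.
have iota_inj : injective iota.
  by move=> i j /enum_rank_inj/val_inj/enum_val_inj.
have v'_surj y : exists2 i, (i < k)%N & v' i = y.
  have [i ik vi] := proj1 (vD _) (valP (enum_val y : delete D)); exists i => //.
  by apply: iota_inj; rewrite -vE // vi.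
apply: (@koszul_reg_le_embed K #|G| _ v v' _ _ iota iota_inj vE v'_surj _ r).
  by move=> i j; rewrite /edge_rel /iota !enum_rankK.
apply: reg => // i j /andP[ij jk].
have : v i != v j by apply: v_inj; rewrite ij (leq_trans jk) // /k card_delete leq_subr.
by rewrite !vE ?(ltn_trans ij) //; apply: contraNneq => ->.
Qed.
End VertexDeletion.

(** The edgeless case of G - st x is a disjunct of its own: the conventional value 2 may exceed c -
    1, although the ideal is then 0. *)
Lemma reg_delete_vertex (K : fieldType) (R : realType) (G : sgraph) (x : G) (c : R) :
  2 <= c -> (reg_edge_ideal K (delete [set x]) R <= c%:E)%E ->
  edgeless (delete (star x)) \/ (reg_edge_ideal K (delete (star x)) R <= (c - 1)%:E)%E ->
  (reg_edge_ideal K G R <= c%:E)%E.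
Proof.
move=> c2 reg_x reg_st; have c0 : 0 <= c by apply: le_trans c2.
have [v [v_inj v_surj v_last v_star]] := star_last_enum_exists x.
(* From c >= 2 the floor of c is r + 2 and that of c - 1 is r + 1, which remains a successor as
   adding the neighbours requires. *)
have [r rE] : exists r, Num.truncn c = r.+2.
  exists (Num.truncn c).-2; case: (Num.truncn c) (truncn_ge_nat 2 c0) => [|[|r]] //.
  + by rewrite c2.
  + by rewrite c2.
have [k kE] : exists k, #|G| = k.+1.
  by exists #|G|.-1; rewrite prednK //; apply/card_gt0P; exists x.
have {}v_last : v k = enum_rank x.
  by rewrite -v_last (_ : k = #|G|.-1) // (congr1 predn kE).
have k_x : #|delete [set x]| = k by rewrite card_delete cards1 kE subn1.
have vk i : (i < k)%N -> v i != v k by move=> ik; rewrite v_inj // ik kE ltnSn.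
have v_eq i j : (i < #|G|)%N -> (j < #|G|)%N -> v i = v j -> i = j.
  move=> iG jG vij; case: (ltngtP i j) => // ij.
    by have := v_inj i j; rewrite ij jG vij eqxx => /(_ isT).
  by have := v_inj j i; rewrite ij iG vij eqxx => /(_ isT).
set a := #|delete (star x)| in v_star *.
have a_le_k : (a <= k)%N by rewrite /a card_delete card_star kE subSS leq_subr.
have regx : koszul_reg_le K v k (extended_edge_monomial v (edge_rel (G := G)) k k k) r.+2.
  apply: (koszul_reg_le_delete v_inj (esym k_x)).
    move=> y; rewrite inE; split=> [yx|[i ik vi]]; last first.
      by apply: contraNneq (vk i ik) => yx; rewrite vi v_last yx.
    have [i iG vi] := v_surj (enum_rank y).
    have : (i <= k)%N by rewrite -ltnS -kE.
    rewrite leq_eqVlt => /orP[/eqP iE|ik]; last by exists i.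
    move: vi; rewrite iE v_last => /enum_rank_inj xy.
    by rewrite xy eqxx in yx.
  by move=> v' v'_inj v'_surj; rewrite -rE; exact: reg_koszul_le reg_x.
have regst : koszul_reg_le K v a (extended_edge_monomial v (edge_rel (G := G)) a a a) r.+1.
  apply: (koszul_reg_le_delete v_inj (erefl a)) => // v' v'_inj v'_surj.
  have <- : Num.truncn (c - 1) = r.+1.
    apply: truncn_def; have := truncn_itv c0; rewrite rE => /andP[rc cr].
    by rewrite lerBrDr ltrBlDr !natr1 rc cr.
  case: reg_st => [noE|regc].
    apply: koszul_reg_le_empty => m [i [j [eij _ _]]].
    by move: eij; apply/negP/noE.
  by apply: reg_koszul_le regc => //; rewrite subr_ge0 (le_trans _ c2) // ler1n.
apply: (koszul_le_reg v_inj v_surj (r := r.+2)) => //.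
  by rewrite -rE; have /andP[] := truncn_itv c0.
have v_inj' i j : (i < j < k.+1)%N -> v i != v j by rewrite -kE; exact: v_inj.
have := @koszul_reg_le_add_vertex K #|G| v (edge_rel (G := G)) a k r.+1 v_inj'.
rewrite -kE => step.
apply: koszul_reg_leW (leqnn _) _ (step _ _ _ regx _).
- move=> m; split=> [[_ [[i]|//]]|me]; first by case: ltngtP.
  by split; [move=> y _; exact: v_surj | right].
- by move=> i j; rewrite /edge_rel sedge_sym.
- by move=> i; rewrite /edge_rel sedge_irr.
- move=> i ik; rewrite /edge_rel v_last enum_rankK.
  have ix : enum_val (v i) != x.
    by apply: contraNneq (vk i ik) => ix; rewrite v_last -ix enum_valK.
  have -> : sedge x (enum_val (v i)) = (enum_val (v i) \in star x).
    by rewrite !inE (negbTE ix) orbF.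
  rewrite leqNgt -[LHS]negbK; congr negb; apply/idP/idP.
    move/v_star => [j ja vj].
    have iG : (i < #|G|)%N by rewrite kE ltnW.
    have jG : (j < #|G|)%N by rewrite kE ltnS (leq_trans (ltnW ja)).
    by have <- : j = i by apply: v_eq; rewrite // vj enum_valK.
  by move=> ia; apply/v_star; exists i; rewrite ?enum_valK.
- apply: koszul_reg_le_add_vars => // i j /andP[ij jk].
  by rewrite v_inj // ij kE ltnW.
Qed.

(** If the chord from x - D to x had slope below f'(x), difference quotients at points just left of
    x would exceed that slope, whereas concavity keeps f above the chord. *)
Lemma concave_tangent (R : realType) (f f' : R -> R) (x D : R) :
  concave_nonneg f -> derivative_nonneg f f' -> 0 < D -> D <= x ->
  D * f' x <= f x - f (x - D).
Proof.
move=> f_concave f_diff D0 Dx; have x0 : 0 <= x by exact: le_trans (ltW D0) Dx.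
rewrite mulrC -ler_pdivlMr // leNgt; apply/negP => slope.
have /nbhs_ballP[eps /= eps0 near_slope] : nbhs x (fun y => y != x -> 0 <= y ->
    (f x - f (x - D)) / D < (f y - f x) / (y - x)).
  exact: cvgr_gt (f_diff x x0) _ slope.
(* The point x - t D lies on the segment because t <= 1, and strictly inside the ball because t D <=
   eps / 2. *)
pose t := Num.min 1 (eps / 2 / D).
have t0 : 0 < t by rewrite lt_min ltr01 !divr_gt0.
have t1 : t <= 1 by rewrite ge_min lexx.
have tD : t * D <= eps / 2 by rewrite -ler_pdivlMr // ge_min lexx orbT.
have tDx : t * D <= x by apply: le_trans Dx; rewrite ger_pMl.
have := near_slope (x - t * D).
rewrite /ball /= opprB addrC subrK gtr0_norm ?mulr_gt0 //.
have -> : t * D < eps by apply: le_lt_trans tD _; rewrite ltr_pdivrMr // ltr_pMr // ltr1n.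
move=> /(_ isT); rewrite lt_eqF ?subr_ge0 ?tDx; last by rewrite ltrBlDr ltrDl mulr_gt0.
move=> /(_ isT isT).
have -> : x - t * D - x = - (t * D) by rewrite addrAC subrr add0r.
rewrite invrN mulrN -mulNr opprB ltNge => /negP; apply.
rewrite ler_pdivrMr ?mulr_gt0 // mulrCA mulrA -(mulrA t) divfK ?gt_eqF //.
have := f_concave (x - D) x t; rewrite subr_ge0 => /(_ Dx x0 (ltW t0) t1).
have -> : t * (x - D) + (1 - t) * x = x - t * D.
  by rewrite mulrBr mulrBl mul1r addrC addrA addrNK.
rewrite mulrBl mul1r addrCA => slope_t.
by rewrite mulrBr lerBlDr -lerBlDl opprB.
Qed.

(** * The induction on the number of vertices *)

Theorem lemma4p3 (K : fieldType) (R : realType) (P : sgraph -> Prop)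
    (g f f' f'' : R -> R)
    (P_stable : stable P)
    (g_ge0 : nonneg_valued g) (g_mono : nondecreasing_nonneg g)
    (f_ge0 : nonneg_valued f) (f_mono : nondecreasing_nonneg f)
    (reg_le_g : forall (G : sgraph) (d : R), P G -> 0 <= d ->
       (forall x : G, (degree x)%:R <= d) ->
       (reg_edge_ideal K G R <= (g d)%:E)%E)
    (f_concave : concave_nonneg f)
    (f_diff : derivative_nonneg f f') (f_diff2 : derivative_nonneg f' f'')
    (f1_ge2 : 2 <= f 1)
    (f_cond : forall x : R, 0 <= x ->
       [/\ 0 < f' x, 0 <= 1 / f' x - 1 & g (1 / f' x - 1) <= f x])
    (n : nat) (n_ge1 : (1 <= n)%N)
    (G : sgraph) (G_card : #|G| = n) (PG : P G) :
  (reg_edge_ideal K G R <= (f n%:R)%:E)%E.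
Proof.
elim/ltn_ind: n G n_ge1 G_card PG => n IH G n_ge1 G_card PG.
have [f'n_gt0 d_ge0 g_le_f] := f_cond n%:R (ler0n R n).
set d := 1 / f' n%:R - 1 in d_ge0 g_le_f.
have [deg_le|/existsNP[y /negP]] := pselect (forall x : G, (degree x)%:R <= d).
  by apply: le_trans (reg_le_g G d PG d_ge0 deg_le) _; rewrite lee_fin.
rewrite -ltNge => deg_y.
pose x := [arg max_(x > y) degree x].
have x_max : has_max_degree x.
  by rewrite /x; case: arg_maxnP => // i _ i_max z; exact: i_max.
have deg_x : d < (degree x)%:R by apply: lt_le_trans deg_y _; rewrite ler_nat x_max.
have [P_st P_x] := P_stable G x PG x_max.
(* The maximal degree exceeds d >= 0, so n >= 2 and the induction hypothesis applies to G - x. *)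
have deg_gt0 : (0 < degree x)%N by rewrite -(ltr0n R) (le_lt_trans d_ge0).
have card_x : #|delete [set x]| = n.-1 by rewrite card_delete cards1 G_card subn1.
have card_st : #|delete (star x)| = (n - (degree x).+1)%N.
  by rewrite card_delete card_star G_card.
have deg_lt_n : (degree x < n)%N by rewrite -G_card -card_star max_card.
have n_gt1 : (1 < n)%N by exact: leq_ltn_trans deg_lt_n.
apply: (@reg_delete_vertex _ _ _ x).
- by apply: le_trans f1_ge2 _; apply: f_mono; rewrite ?ler01 // ler1n.
- have n1_lt : (n.-1 < n)%N by rewrite ltn_predL.
  have n1_gt0 : (0 < n.-1)%N by rewrite -subn1 subn_gt0.
  apply: le_trans (IH _ n1_lt _ n1_gt0 card_x P_x) _.
  by rewrite lee_fin f_mono ?ler0n // ler_nat leq_pred.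
(* The edgeless case includes a star covering all of G; otherwise G - st x has a vertex, as the
   induction hypothesis demands. *)
have [noE|E] := pselect (edgeless (delete (star x))); [by left|right].
have st_gt0 : (0 < n - (degree x).+1)%N.
  rewrite -card_st lt0n; apply/eqP => st0; apply: E => z.
  by have := fintype0 z st0.
have st_lt : (n - (degree x).+1 < n)%N by rewrite ltn_subrL.
apply: le_trans (IH _ st_lt _ st_gt0 card_st P_st) _.
(* It remains to show 1 <= f(n) - f(n - (D + 1)) with D the degree of x; the tangent bound reduces
   this to 1 <= (D + 1) f'(n), that is, d <= D. *)
rewrite lee_fin lerBrDr natrB // -lerBrDl.
have degS_gt0 : (0 : R) < (degree x).+1%:R by rewrite ltr0n.
have := @concave_tangent _ f f' n%:R (degree x).+1%:R f_concave f_diff degS_gt0.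
rewrite ler_nat => /(_ deg_lt_n); apply: le_trans.
by rewrite -ler_pdivrMr // -natr1 -lerBlDr ltW.
Qed.
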